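(* A countable discrete group $G$ is amenable at infinity if and only if it admits an amenable action on the Hilbert cube $I^{\aleph_0}=[0,1]^{\mathbb N}$.
   Context: For a countable discrete group $G$, $\mathbb P(G)=\{b\colon G\to[0,1] : \sum_{g}b(g)=1\}\subset\ell^1(G)$ carries the weak* (pointwise) topology, and $G$ acts on it by $(gb)(h)=b(g^{-1}h)$. An action of $G$ by homeomorphisms on a compact Hausdorff space $X$ is amenable if there is a sequence of continuous maps $b^n\colon X\to\mathbb P(G)$ such that for every $g\in G$, $\lim_{n\to\infty}\sup_{x\in X}\|g b^n_x-b^n_{gx}\|_1=0$. $G$ is amenable at infinity if it admits an amenable action on some compact Hausdorff space. *)

(* Defs.v *)
From Stdlib Require Import Reals List.
Open Scope R_scope.

Record group := Group {
  gcar :> Type;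
  gmul : gcar -> gcar -> gcar;
  ginv : gcar -> gcar;
  gone : gcar;
  gmulA : forall a b c, gmul a (gmul b c) = gmul (gmul a b) c;
  gmul1l : forall a, gmul gone a = a;
  gmulVl : forall a, gmul (ginv a) a = gone
}.

(** G is countable: enumerated by nat (G is nonempty since it contains 1). *)
Definition countable_group (G : group) : Prop :=
  exists f : nat -> G, forall g : G, exists n, f n = g.

Definition lsum {A : Type} (f : A -> R) (L : list A) : R :=
  fold_right (fun a s => f a + s) 0 L.

(** b belongs to P(G): values in [0,1] and sum_g b(g) = 1, where the
    (unordered, possibly infinite) sum of a nonnegative family is the
    supremum of its finite partial sums. *)
Definition is_prob {G : Type} (b : G -> R) : Prop :=
  (forall g, 0 <= b g <= 1) /\
  (forall L : list G, NoDup L -> lsum b L <= 1) /\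
  (forall eps, eps > 0 -> exists L : list G, NoDup L /\ lsum b L > 1 - eps).

Definition transl (G : group) (g : G) (b : G -> R) : G -> R :=
  fun h => b (gmul G (ginv G g) h).

Definition is_topology {X : Type} (op : (X -> Prop) -> Prop) : Prop :=
  op (fun _ => True) /\
  (forall U V, op U -> op V -> op (fun x => U x /\ V x)) /\
  (forall (I : Type) (F : I -> X -> Prop),
      (forall i, op (F i)) -> op (fun x => exists i, F i x)).

Definition compact {X : Type} (op : (X -> Prop) -> Prop) : Prop :=
  forall (I : Type) (F : I -> X -> Prop),
    (forall i, op (F i)) -> (forall x, exists i, F i x) ->
    exists L : list I, forall x, exists i, In i L /\ F i x.

Definition hausdorff {X : Type} (op : (X -> Prop) -> Prop) : Prop :=
  forall x y : X, x <> y ->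
    exists U V, op U /\ op V /\ U x /\ V y /\ (forall z, ~ (U z /\ V z)).

Definition continuous {X Y : Type} (opX : (X -> Prop) -> Prop)
  (opY : (Y -> Prop) -> Prop) (f : X -> Y) : Prop :=
  forall V, opY V -> opX (fun x => V (f x)).

Definition continuous_R {X : Type} (op : (X -> Prop) -> Prop) (f : X -> R) : Prop :=
  forall x eps, eps > 0 ->
    exists U, op U /\ U x /\ (forall y, U y -> Rabs (f y - f x) < eps).

(** An action of G on X by homeomorphisms (each act g is continuous with
    continuous inverse act g^{-1}). *)
Definition is_action (G : group) {X : Type} (op : (X -> Prop) -> Prop)
  (act : G -> X -> X) : Prop :=
  (forall x, act (gone G) x = x) /\
  (forall g h x, act (gmul G g h) x = act g (act h x)) /\
  (forall g, continuous op op (act g)).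

(** Amenable action: maps b^n : X -> P(G), continuous for the weak*
    (= pointwise) topology on P(G), i.e. each x |-> b^n_x(h) is continuous,
    with lim_n sup_x || g b^n_x - b^n_{gx} ||_1 = 0 for every g.
    The l^1 norm is the supremum of finite partial sums of |.|. *)
Definition amenable_action (G : group) {X : Type} (op : (X -> Prop) -> Prop)
  (act : G -> X -> X) : Prop :=
  exists b : nat -> X -> G -> R,
    (forall n x, is_prob (b n x)) /\
    (forall n (h : G), continuous_R op (fun x => b n x h)) /\
    (forall (g : G) eps, eps > 0 ->
       exists N : nat, forall n, (N <= n)%nat -> forall (x : X) (L : list G),
         NoDup L ->
         lsum (fun h => Rabs (transl G g (b n x) h - b n (act g x) h)) L <= eps).

Definition amenable_at_infinity (G : group) : Prop :=
  exists (X : Type) (op : (X -> Prop) -> Prop),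
    is_topology op /\ compact op /\ hausdorff op /\ inhabited X /\
    exists act : G -> X -> X, is_action G op act /\ amenable_action G op act.

Definition hcube : Type := { x : nat -> R | forall n, 0 <= x n <= 1 }.

Definition hcube_open (U : hcube -> Prop) : Prop :=
  forall x, U x -> exists (N : nat) (eps : R), eps > 0 /\
    forall y : hcube,
      (forall k, (k < N)%nat -> Rabs (proj1_sig y k - proj1_sig x k) < eps) -> U y.

(* Main.v *)
Require Import Defs.
From Stdlib Require Import Reals List Lra Lia ZArith Bool Cantor FinFun.
From Stdlib Require Import ClassicalEpsilon FunctionalExtensionality ProofIrrelevance.
Open Scope R_scope.

(** Only the passage from an amenable action on some [X] to one on the cube
    needs an idea. Restrict the maps [b^n] to an orbit and round them to maps
    [beta^n : G -> P(G)] with finite range and finite common support; they are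
    measurable for a countable, translation invariant Boolean algebra of
    subsets of [G]. The group acts by push-forward on the compact convex space
    [K] of finitely additive probabilities (means) on this algebra, and taking
    barycentres extends [beta^n] to [K] without increasing the defect of
    equivariance.

    It remains to identify [K x [-1,1]^N], with [G] acting trivially on the
    second factor, with the cube. The algebra is generated by a binary tree
    of cells; a mean is given by choosing, for each cell of mass [r] with two
    nonempty children, the mass [s] in [[0,r]] of the left child. There is a
    homeomorphism over [r] between [{(r,s) : 0 <= s <= r} x [-1,1]^N] and
    [[0,1] x [-1,1]^N], in spite of the degenerate fibre at [r = 0]. Using one
    copy of it for each cell yields explicit mutually inverse continuous maps
    between [K x [-1,1]^N] and the cube. *)

(** * Splitting an interval off the cube, fibrewise *)

(** The sup norm of the plane, chosen because its unit ball is the square, a product of two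
    coordinate intervals. *)
Definition nrm (a b : R) : R := Rmax (Rabs a) (Rabs b).

Lemma nrm_ge0 a b : 0 <= nrm a b.
Proof. unfold nrm. pose proof (Rmax_l (Rabs a) (Rabs b)). pose proof (Rabs_pos a). lra. Qed.

Lemma nrm_l a b : Rabs a <= nrm a b.
Proof. apply Rmax_l. Qed.

Lemma nrm_r a b : Rabs b <= nrm a b.
Proof. apply Rmax_r. Qed.

Lemma nrm_eq0 a b : nrm a b = 0 -> a = 0 /\ b = 0.
Proof.
  intros H. pose proof (nrm_l a b) as Ha. pose proof (nrm_r a b) as Hb.
  rewrite H in *. split; revert Ha Hb; unfold Rabs; do 2 destruct Rcase_abs; lra.
Qed.

Lemma nrm_scal l a b : 0 <= l -> nrm (l * a) (l * b) = l * nrm a b.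
Proof.
  intros H. unfold nrm. rewrite !Rabs_mult, (Rabs_pos_eq l H).
  apply RmaxRmult, H.
Qed.

Lemma nrm_pos a b : ~ (a = 0 /\ b = 0) -> 0 < nrm a b.
Proof.
  intros H. destruct (nrm_ge0 a b) as [?|E]; trivial.
  symmetry in E. now apply nrm_eq0 in E.
Qed.

(** [(rx, ry)] is the linear similarity with matrix [[al, be], [-be, al]],
    rescaled radially so as to preserve the sup norm, hence the square
    [[-1,1]^2]; the inverse is obtained by changing the sign of [be]. *)
Definition rx (al be c q : R) : R :=
  nrm c q / nrm (al * c + be * q) (al * q - be * c) * (al * c + be * q).
Definition ry (al be c q : R) : R :=
  nrm c q / nrm (al * c + be * q) (al * q - be * c) * (al * q - be * c).

(** The transpose times the matrix is the scalar [al * al + be * be], so a vector killed by the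
    matrix is zero. *)
Lemma rot_nondeg al be c q : 0 < al * al + be * be -> 0 < nrm c q ->
  0 < nrm (al * c + be * q) (al * q - be * c).
Proof.
  intros HD Hn. apply nrm_pos. intros [Ha Hb].
  assert (Hc : (al * al + be * be) * c = 0).
  { replace ((al * al + be * be) * c)
      with (al * (al * c + be * q) - be * (al * q - be * c)) by ring.
    rewrite Ha, Hb; ring. }
  assert (Hq : (al * al + be * be) * q = 0).
  { replace ((al * al + be * be) * q)
      with (be * (al * c + be * q) + al * (al * q - be * c)) by ring.
    rewrite Ha, Hb; ring. }
  apply Rmult_integral in Hc; apply Rmult_integral in Hq.
  destruct Hc as [?|Hc]; [lra|]. destruct Hq as [?|Hq]; [lra|].
  subst. unfold nrm in Hn. rewrite Rabs_R0, Rmax_left in Hn; lra.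
Qed.

Lemma rot_norm al be c q : 0 < al * al + be * be ->
  nrm (rx al be c q) (ry al be c q) = nrm c q.
Proof.
  intros HD. unfold rx, ry. destruct (nrm_ge0 c q) as [Hn|Hn].
  - pose proof (rot_nondeg al be c q HD Hn) as Hn'. rewrite nrm_scal.
    + field. lra.
    + apply Rlt_le, Rdiv_lt_0_compat; lra.
  - rewrite <- Hn. unfold Rdiv. rewrite !Rmult_0_l.
    unfold nrm. rewrite Rabs_R0. apply Rmax_left; lra.
Qed.

(** The transpose inverts the matrix up to a positive scalar, and the radial rescaling absorbs that
    scalar because the first map preserves [nrm]. *)
Lemma rot_cancel al be c q : 0 < al * al + be * be ->
  rx al (- be) (rx al be c q) (ry al be c q) = c /\
  ry al (- be) (rx al be c q) (ry al be c q) = q.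
Proof.
  intros HD. pose proof (rot_norm al be c q HD) as HN.
  set (x := rx al be c q) in *. set (y := ry al be c q) in *.
  unfold rx, ry. rewrite HN. unfold x, y, rx, ry. clear x y HN. destruct (nrm_ge0 c q) as [Hn|Hn].
  - pose proof (rot_nondeg al be c q HD Hn) as Hn'.
    set (n' := nrm (al * c + be * q) (al * q - be * c)) in *.
    set (n := nrm c q) in *.
    set (D := al * al + be * be) in *.
    replace (al * (n / n' * (al * c + be * q)) + - be * (n / n' * (al * q - be * c)))
      with (n / n' * D * c) by (unfold D; field; lra).
    replace (al * (n / n' * (al * q - be * c)) - - be * (n / n' * (al * c + be * q)))
      with (n / n' * D * q) by (unfold D; field; lra).
    assert (0 < n / n' * D).
    { apply Rmult_lt_0_compat; trivial. apply Rdiv_lt_0_compat; lra. }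
    rewrite nrm_scal by lra. fold n.
    split; field; repeat split; lra.
  - symmetry in Hn. rewrite Hn. apply nrm_eq0 in Hn. destruct Hn; subst.
    unfold Rdiv. rewrite !Rmult_0_l. auto.
Qed.

Lemma rot_cancel' al be c q : 0 < al * al + be * be ->
  rx al be (rx al (- be) c q) (ry al (- be) c q) = c /\
  ry al be (rx al (- be) c q) (ry al (- be) c q) = q.
Proof.
  intros HD. pose proof (rot_cancel al (- be) c q) as H.
  rewrite Ropp_involutive in H. apply H. lra.
Qed.

Lemma div_mul_same n c : (c <> 0 -> n <> 0) -> n / n * c = c.
Proof.
  intros H. destruct (Req_dec c 0) as [->|Hc]; [ring|]. field. auto.
Qed.

Lemma rx_id c q : rx 1 0 c q = c.
Proof.
  unfold rx. replace (1 * c + 0 * q) with c by ring.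
  replace (1 * q - 0 * c) with q by ring. apply div_mul_same.
  intros H E. apply nrm_eq0 in E. tauto.
Qed.

Lemma nrm_swap a b : nrm a b = nrm b a.
Proof. apply Rmax_comm. Qed.

Lemma nrm_opp_r a b : nrm a (- b) = nrm a b.
Proof. unfold nrm. now rewrite Rabs_Ropp. Qed.

Lemma rx_turn c q : rx 0 1 c q = q.
Proof.
  unfold rx. replace (0 * c + 1 * q) with q by ring.
  replace (0 * q - 1 * c) with (- c) by ring.
  rewrite nrm_opp_r, (nrm_swap q c). apply div_mul_same.
  intros H E. apply nrm_eq0 in E. tauto.
Qed.

Lemma ry_turn c q : ry 0 (- 1) c q = c.
Proof.
  unfold ry. replace (0 * c + - 1 * q) with (- q) by ring.
  replace (0 * q - - 1 * c) with c by ring.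
  rewrite (nrm_swap (- q) c), nrm_opp_r. apply div_mul_same.
  intros H E. apply nrm_eq0 in E. tauto.
Qed.

Lemma rot_range al be c q : 0 < al * al + be * be ->
  Rabs c <= 1 -> Rabs q <= 1 ->
  Rabs (rx al be c q) <= 1 /\ Rabs (ry al be c q) <= 1.
Proof.
  intros HD Hc Hq. pose proof (rot_norm al be c q HD) as HN.
  pose proof (nrm_l (rx al be c q) (ry al be c q)).
  pose proof (nrm_r (rx al be c q) (ry al be c q)).
  assert (nrm c q <= 1) by (apply Rmax_lub; trivial). lra.
Qed.

(** The angle of the [k]-th turn: a full quarter turn for [(k+1) r <= 1],
    none for [(k+1) r >= 2]. *)
Definition th (k : nat) (r : R) : R := Rmax 0 (Rmin 1 (2 - INR (S k) * r)).

Lemma th_full k r : INR (S k) * r <= 1 -> th k r = 1.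
Proof. intros H. unfold th. rewrite Rmin_left, Rmax_right; lra. Qed.

Lemma th_null k r : 2 <= INR (S k) * r -> th k r = 0.
Proof. intros H. unfold th. rewrite Rmax_left; trivial. rewrite Rmin_right; lra. Qed.

Lemma th_nondeg t : 0 < (1 - t) * (1 - t) + t * t.
Proof. nra. Qed.

Lemma th_nondeg' t : 0 < (1 - t) * (1 - t) + - t * - t.
Proof. nra. Qed.

(** Fibrewise over [r] in [[0,1]], the maps [s, q |-> fib r s q] and
    [z |-> (fib_mass r z, fib_rest r z)] are inverse bijections between
    [[0,r] x [-1,1]^N] and [[-1,1]^N]. The normalised coordinate
    [2 s / r - 1] is carried along the sequence [q], being exchanged with its
    successive terms by quarter turns; as [r -> 0] it is pushed off to
    infinity, which makes the map continuous where the fibre [[0,r]]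
    degenerates. *)
Fixpoint carry (r s : R) (q : nat -> R) (k : nat) : R :=
  match k with
  | O => 2 * s / r - 1
  | S k' => ry (1 - th k' r) (th k' r) (carry r s q k') (q k')
  end.

Definition fib (r s : R) (q : nat -> R) (k : nat) : R :=
  rx (1 - th k r) (th k r) (carry r s q k) (q k).

Fixpoint back (r : R) (z : nat -> R) (k n : nat) : R :=
  match n with
  | O => z k
  | S n' => rx (1 - th k r) (- th k r) (z k) (back r z (S k) n')
  end.

(** For [r > 0], turns of index at least [2 / r] are trivial, so the backward recursion cut off here
    has reached its final value. *)
Definition steps (r : R) : nat := Z.to_nat (up (2 / r)).

Definition uncarry (r : R) (z : nat -> R) (k : nat) : R := back r z k (steps r).

Definition fib_mass (r : R) (z : nat -> R) : R := r * (1 + uncarry r z 0) / 2.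

Definition fib_rest (r : R) (z : nat -> R) (k : nat) : R :=
  ry (1 - th k r) (- th k r) (z k) (uncarry r z (S k)).

Lemma steps_large r : 0 < r -> 2 <= INR (steps r) * r.
Proof.
  intros Hr. unfold steps.
  assert (0 < 2 / r) by (apply Rdiv_lt_0_compat; lra).
  destruct (archimed (2 / r)) as [Hu _].
  rewrite INR_IZR_INZ, Z2Nat.id by (apply le_IZR; lra).
  apply Rmult_le_reg_r with (/ r); [now apply Rinv_0_lt_compat|].
  replace (IZR (up (2 / r)) * r * / r) with (IZR (up (2 / r))) by (field; lra).
  fold (2 / r). lra.
Qed.

Lemma INR_scale_le n m r : (n <= m)%nat -> 0 <= r -> INR n * r <= INR m * r.
Proof. intros H Hr. apply Rmult_le_compat_r; trivial. now apply le_INR. Qed.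

(** From index [k + n] on all turns are trivial, so [back] returns [z (k + n)] there however many
    steps remain. *)
Lemma back_stable r z n : 0 <= r -> forall k n', 2 <= INR (S (k + n)) * r -> (n <= n')%nat ->
  back r z k n' = back r z k n.
Proof.
  intros Hr. induction n as [|n IH]; intros k n' H Hn.
  - destruct n' as [|n']; trivial. cbn [back].
    rewrite th_null by (rewrite Nat.add_0_r in H; trivial).
    rewrite Rminus_0_r, Ropp_0. apply rx_id.
  - destruct n' as [|n']; [lia|]. cbn [back].
    rewrite (IH (S k) n'); trivial; [|lia].
    now replace (S k + n)%nat with (k + S n)%nat by lia.
Qed.

Lemma uncarry_back r z k n : 0 < r -> 2 <= INR n * r -> uncarry r z k = back r z k n.
Proof.
  intros Hr Hn. unfold uncarry. pose proof (steps_large r Hr) as Hs.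
  destruct (Nat.le_ge_cases n (steps r)) as [H|H].
  - apply back_stable; trivial; [lra|].
    eapply Rle_trans; [exact Hn|]. apply INR_scale_le; [lia|lra].
  - symmetry. apply back_stable; trivial; [lra|].
    eapply Rle_trans; [exact Hs|]. apply INR_scale_le; [lia|lra].
Qed.

Lemma uncarry_step r z k : 0 < r ->
  uncarry r z k = rx (1 - th k r) (- th k r) (z k) (uncarry r z (S k)).
Proof.
  intros Hr. rewrite (uncarry_back r z k (S (steps r))); trivial.
  eapply Rle_trans; [apply steps_large, Hr|]. apply INR_scale_le; [lia|lra].
Qed.

(** Where the turn is trivial, [fib] outputs the carried coordinate itself; descending from there,
    each inverse turn recovers the preceding one. *)
Lemma uncarry_fib r s q k : 0 < r -> uncarry r (fib r s q) k = carry r s q k.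
Proof.
  intros Hr. unfold uncarry.
  assert (H : forall n k, 2 <= INR (S (k + n)) * r ->
    back r (fib r s q) k n = carry r s q k).
  { clear k. induction n as [|n IH]; intros k H; cbn [back].
    - unfold fib. rewrite th_null by (rewrite Nat.add_0_r in H; trivial).
      rewrite Rminus_0_r. apply rx_id.
    - rewrite IH by (now replace (S k + n)%nat with (k + S n)%nat by lia).
      unfold fib. cbn [carry]. apply rot_cancel, th_nondeg. }
  apply H. eapply Rle_trans; [apply steps_large, Hr|]. apply INR_scale_le; [lia|lra].
Qed.

Lemma fib_mass_fib r s q : 0 <= s <= r -> fib_mass r (fib r s q) = s.
Proof.
  intros H. unfold fib_mass. destruct (Req_dec r 0) as [->|Hr]; [lra|].
  rewrite uncarry_fib by lra. cbn [carry]. field. trivial.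
Qed.

Lemma fib_rest_full r z k : INR (S k) * r <= 1 -> fib_rest r z k = z k.
Proof.
  intros H. unfold fib_rest. rewrite th_full, Rminus_diag by trivial. apply ry_turn.
Qed.

(** A quarter turn outputs the stored term whatever is being carried, so the division by zero in
    [carry] at [r = 0] never shows. *)
Lemma fib_full r s q k : INR (S k) * r <= 1 -> fib r s q k = q k.
Proof.
  intros H. unfold fib. rewrite th_full, Rminus_diag by trivial. apply rx_turn.
Qed.

Lemma fib_rest_fib r s q k : 0 <= r -> fib_rest r (fib r s q) k = q k.
Proof.
  intros H. destruct (Req_dec r 0) as [->|Hr].
  - rewrite fib_rest_full, fib_full; lra.
  - unfold fib_rest. rewrite uncarry_fib by lra. unfold fib. cbn [carry].
    apply rot_cancel, th_nondeg.
Qed.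

Lemma fib_fib_rest r z k : 0 <= r -> fib r (fib_mass r z) (fib_rest r z) k = z k.
Proof.
  intros H. destruct (Req_dec r 0) as [->|Hr].
  - rewrite fib_full, fib_rest_full; lra.
  (* The forward recursion on the decoded data retraces the carried coordinates found by the
     backward one. *)
  - assert (Hc : forall k, carry r (fib_mass r z) (fib_rest r z) k = uncarry r z k).
    { clear k. induction k as [|k IH]; cbn [carry].
      - unfold fib_mass. field. trivial.
      - rewrite IH, uncarry_step by lra. unfold fib_rest. apply rot_cancel', th_nondeg. }
    unfold fib. rewrite Hc, uncarry_step by lra. unfold fib_rest.
    apply rot_cancel', th_nondeg.
Qed.

Lemma carry_range r s q k : 0 < r -> 0 <= s <= r -> (forall k, Rabs (q k) <= 1) ->
  Rabs (carry r s q k) <= 1.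
Proof.
  intros Hr Hs Hq. induction k as [|k IH]; cbn [carry].
  - assert (0 <= s / r) by (apply Rle_mult_inv_pos; lra).
    assert (s / r <= 1).
    { apply Rmult_le_reg_r with r; trivial.
      replace (s / r * r) with s by (field; lra). lra. }
    replace (2 * s / r - 1) with (2 * (s / r) - 1) by (field; lra).
    apply Rabs_le. lra.
  - apply rot_range; auto. apply th_nondeg.
Qed.

Lemma fib_range r s q k : 0 <= s <= r -> (forall k, Rabs (q k) <= 1) ->
  Rabs (fib r s q k) <= 1.
Proof.
  intros Hs Hq. destruct (Req_dec r 0) as [->|Hr].
  - rewrite fib_full; auto. lra.
  - apply rot_range; auto; [apply th_nondeg|]. apply carry_range; auto. lra.
Qed.

Lemma uncarry_range r z k : (forall k, Rabs (z k) <= 1) -> Rabs (uncarry r z k) <= 1.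
Proof.
  intros Hz. unfold uncarry. generalize (steps r); intros n. revert k.
  induction n as [|n IH]; intros k; cbn [back]; trivial.
  apply rot_range; auto. apply th_nondeg'.
Qed.

Lemma fib_mass_range r z : 0 <= r -> (forall k, Rabs (z k) <= 1) ->
  0 <= fib_mass r z <= r.
Proof.
  intros Hr Hz. unfold fib_mass.
  pose proof (uncarry_range r z 0 Hz) as H.
  assert (-1 <= uncarry r z 0 <= 1) by (revert H; unfold Rabs; destruct Rcase_abs; lra).
  nra.
Qed.

Lemma fib_rest_range r z k : (forall k, Rabs (z k) <= 1) -> Rabs (fib_rest r z k) <= 1.
Proof.
  intros Hz. apply rot_range; auto; [apply th_nondeg'|]. now apply uncarry_range.
Qed.

(** * Continuity on the Hilbert cube *)

(** Neighbourhoods for the product topology: [hcube_open U] says that [U] is a neighbourhood of each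
    of its points. *)
Definition nb (z : hcube) (U : hcube -> Prop) : Prop :=
  exists (N : nat) (eps : R), eps > 0 /\
    forall y : hcube,
      (forall k, (k < N)%nat -> Rabs (proj1_sig y k - proj1_sig z k) < eps) -> U y.

Lemma nb_and z U V : nb z U -> nb z V -> nb z (fun y => U y /\ V y).
Proof.
  intros (N & e & He & HU) (M & d & Hd & HV).
  exists (max N M), (Rmin e d). split; [now apply Rmin_pos|].
  intros y Hy. pose proof (Rmin_l e d). pose proof (Rmin_r e d).
  split; [apply HU|apply HV]; intros k Hk; (eapply Rlt_le_trans; [apply Hy; lia|trivial]).
Qed.

Lemma nb_imp z (U V : hcube -> Prop) : (forall y, U y -> V y) -> nb z U -> nb z V.
Proof. intros H (N & e & He & HU). exists N, e. auto. Qed.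

Lemma nb_all z (U : hcube -> Prop) : (forall y, U y) -> nb z U.
Proof. intros H. exists O, 1. split; [lra|auto]. Qed.

Definition cont_at (f : hcube -> R) (z : hcube) : Prop :=
  forall eps, eps > 0 -> nb z (fun y => Rabs (f y - f z) < eps).

Lemma cont_at_const c z : cont_at (fun _ => c) z.
Proof. intros e He. apply nb_all. intros _. rewrite Rminus_diag, Rabs_R0. lra. Qed.

Lemma cont_at_coord k z : cont_at (fun y => proj1_sig y k) z.
Proof. intros e He. exists (S k), e. split; auto. Qed.

Lemma cont_at_local f g z : nb z (fun y => f y = g y) -> f z = g z ->
  cont_at f z -> cont_at g z.
Proof.
  intros H Hz Hf e He. eapply nb_imp; [|apply (nb_and _ _ _ H (Hf e He))].
  intros y [E L]. now rewrite <- E, <- Hz.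
Qed.

Lemma cont_at_ext f g z : (forall y, f y = g y) -> cont_at f z -> cont_at g z.
Proof. intros H. apply cont_at_local; auto. now apply nb_all. Qed.

Lemma cont_at_plus f g z : cont_at f z -> cont_at g z -> cont_at (fun y => f y + g y) z.
Proof.
  intros Hf Hg e He.
  eapply nb_imp; [|apply (nb_and _ _ _ (Hf (e / 2) ltac:(lra)) (Hg (e / 2) ltac:(lra)))].
  cbn. intros y [H1 H2].
  replace (f y + g y - (f z + g z)) with ((f y - f z) + (g y - g z)) by ring.
  pose proof (Rabs_triang (f y - f z) (g y - g z)). lra.
Qed.

Lemma cont_at_comp (phi : R -> R) f z : continuity_pt phi (f z) -> cont_at f z ->
  cont_at (fun y => phi (f y)) z.
Proof.
  intros Hphi Hf e He. destruct (Hphi e He) as (d & Hd & H).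
  eapply nb_imp; [|apply (Hf d Hd)]. cbn. intros y Hy.
  destruct (Req_dec (f z) (f y)) as [E|E].
  - rewrite E, Rminus_diag, Rabs_R0. lra.
  - apply (H (f y)). repeat split; trivial.
Qed.

Lemma cont_at_scal c f z : cont_at f z -> cont_at (fun y => c * f y) z.
Proof.
  intros H. apply (cont_at_comp (fun x => c * x)); trivial.
  apply continuity_pt_mult; [now apply continuity_pt_const|].
  apply derivable_continuous_pt, derivable_pt_id.
Qed.

Lemma cont_at_opp f z : cont_at f z -> cont_at (fun y => - f y) z.
Proof.
  intros H. apply cont_at_ext with (fun y => -1 * f y); [intros; ring|].
  now apply cont_at_scal.
Qed.

Lemma cont_at_minus f g z : cont_at f z -> cont_at g z -> cont_at (fun y => f y - g y) z.
Proof. intros Hf Hg. apply cont_at_plus; trivial. now apply cont_at_opp. Qed.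

Lemma cont_at_sq f z : cont_at f z -> cont_at (fun y => f y * f y) z.
Proof.
  intros H. apply (cont_at_comp (fun x => x * x)); trivial.
  apply continuity_pt_mult; apply derivable_continuous_pt, derivable_pt_id.
Qed.

(** Polarization reduces products to squares, which are compositions with a function of one real
    variable. *)
Lemma cont_at_mult f g z : cont_at f z -> cont_at g z -> cont_at (fun y => f y * g y) z.
Proof.
  intros Hf Hg.
  apply cont_at_ext with
    (fun y => 1 / 4 * ((f y + g y) * (f y + g y) - (f y - g y) * (f y - g y))).
  - intros; field.
  - apply cont_at_scal, cont_at_minus; apply cont_at_sq.
    + now apply cont_at_plus.
    + now apply cont_at_minus.
Qed.

Lemma cont_at_div f g z : g z <> 0 -> cont_at f z -> cont_at g z ->
  cont_at (fun y => f y / g y) z.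
Proof.
  intros H Hf Hg. apply cont_at_mult; trivial.
  apply (cont_at_comp Rinv); trivial.
  apply (continuity_pt_inv id); trivial. apply derivable_continuous_pt, derivable_pt_id.
Qed.

Lemma cont_at_abs f z : cont_at f z -> cont_at (fun y => Rabs (f y)) z.
Proof. intros H. apply (cont_at_comp Rabs); trivial. apply Rcontinuity_abs. Qed.

Lemma cont_at_max f g z : cont_at f z -> cont_at g z ->
  cont_at (fun y => Rmax (f y) (g y)) z.
Proof.
  intros Hf Hg.
  apply cont_at_ext with (fun y => 1 / 2 * (f y + g y + Rabs (f y - g y))).
  - intros y. unfold Rmax, Rabs. destruct Rle_dec, Rcase_abs; lra.
  - apply cont_at_scal, cont_at_plus; [now apply cont_at_plus|].
    now apply cont_at_abs, cont_at_minus.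
Qed.

Lemma cont_at_min f g z : cont_at f z -> cont_at g z ->
  cont_at (fun y => Rmin (f y) (g y)) z.
Proof.
  intros Hf Hg.
  apply cont_at_ext with (fun y => - Rmax (- f y) (- g y)).
  - intros y. unfold Rmax, Rmin. do 2 destruct Rle_dec; lra.
  - apply cont_at_opp, cont_at_max; now apply cont_at_opp.
Qed.

Lemma cont_at_nrm f g z : cont_at f z -> cont_at g z -> cont_at (fun y => nrm (f y) (g y)) z.
Proof. intros Hf Hg. apply cont_at_max; now apply cont_at_abs. Qed.

Lemma cont_at_squeeze f g z : f z = 0 -> g z = 0 -> (forall y, Rabs (f y) <= g y) ->
  cont_at g z -> cont_at f z.
Proof.
  intros Hfz Hgz Hle Hg e He. eapply nb_imp; [|apply (Hg e He)].
  intros y. cbn. rewrite Hfz, Hgz, !Rminus_0_r. intros H. pose proof (Hle y).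
  pose proof (Rle_abs (g y)). lra.
Qed.

(** Away from the origin these are quotients with nonzero denominator; at the origin both outputs
    are dominated by [nrm (c y) (q y)], which tends to zero. *)
Lemma cont_at_rot al be c q z : (forall y, 0 < al y * al y + be y * be y) ->
  cont_at al z -> cont_at be z -> cont_at c z -> cont_at q z ->
  cont_at (fun y => rx (al y) (be y) (c y) (q y)) z /\
  cont_at (fun y => ry (al y) (be y) (c y) (q y)) z.
Proof.
  intros HD Ha Hb Hc Hq. destruct (nrm_ge0 (c z) (q z)) as [Hn|Hn].
  - pose proof (rot_nondeg _ _ _ _ (HD z) Hn) as Hn'.
    split; unfold rx, ry;
      (apply cont_at_mult;
       [apply cont_at_div;
         [lra|now apply cont_at_nrm
         |apply cont_at_nrm; [apply cont_at_plus|apply cont_at_minus]; now apply cont_at_mult]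
       |(apply cont_at_minus || apply cont_at_plus); now apply cont_at_mult]).
  - assert (Hle : forall y,
      Rabs (rx (al y) (be y) (c y) (q y)) <= nrm (c y) (q y) /\
      Rabs (ry (al y) (be y) (c y) (q y)) <= nrm (c y) (q y)).
    { intros y. rewrite <- (rot_norm _ _ (c y) (q y) (HD y)). split; [apply nrm_l|apply nrm_r]. }
    split; (apply cont_at_squeeze with (fun y => nrm (c y) (q y));
      [|easy|apply Hle|now apply cont_at_nrm]);
      unfold rx, ry; rewrite <- Hn; unfold Rdiv; ring.
Qed.

Lemma cont_at_th k r z : cont_at r z -> cont_at (fun y => th k (r y)) z.
Proof.
  intros H. apply cont_at_max; [apply cont_at_const|].
  apply cont_at_min; [apply cont_at_const|].
  apply cont_at_minus; [apply cont_at_const|now apply cont_at_scal].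
Qed.

Lemma nb_pos f z : cont_at f z -> 0 < f z -> nb z (fun y => 0 < f y).
Proof.
  intros Hf H. eapply nb_imp; [|apply (Hf (f z) H)]. cbn.
  intros y Hy. apply Rabs_def2 in Hy. lra.
Qed.

Lemma nb_small_scale k r z : r z = 0 -> cont_at r z ->
  nb z (fun y => INR (S k) * r y <= 1).
Proof.
  intros Hz Hr. pose proof (lt_0_INR (S k) ltac:(lia)) as Hk.
  eapply nb_imp; [|apply (nb_pos (fun y => 1 - INR (S k) * r y))].
  - cbn beta. intros; lra.
  - apply cont_at_minus; [apply cont_at_const|now apply cont_at_scal].
  - rewrite Hz. lra.
Qed.

(** Near a point with [r z = 0] the [k]-th turn is full and the output is just [q y k]; elsewhere
    only finitely many continuous operations are composed. *)
Lemma cont_at_fib r s q k z : (forall y, 0 <= r y) ->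
  cont_at r z -> cont_at s z -> (forall j, cont_at (fun y => q y j) z) ->
  cont_at (fun y => fib (r y) (s y) (q y) k) z.
Proof.
  intros Hp Hr Hs Hq. destruct (Req_dec (r z) 0) as [E|E].
  - apply cont_at_local with (fun y => q y k); trivial.
    + eapply nb_imp; [|apply (nb_small_scale k r z E Hr)].
      intros y Hy. symmetry. now apply fib_full.
    + symmetry. apply fib_full. rewrite E; lra.
  - assert (Hc : forall j, cont_at (fun y => carry (r y) (s y) (q y) j) z).
    { induction j as [|j IH]; cbn [carry].
      - apply cont_at_minus; [|apply cont_at_const].
        apply cont_at_div; trivial. now apply cont_at_scal.
      - apply cont_at_rot with (al := fun y => 1 - th j (r y)); auto using cont_at_th.
        + intros; apply th_nondeg.
        + apply cont_at_minus; auto using cont_at_const, cont_at_th. }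
    apply cont_at_rot with (al := fun y => 1 - th k (r y)); auto using cont_at_th.
    + intros; apply th_nondeg.
    + apply cont_at_minus; auto using cont_at_const, cont_at_th.
Qed.

Lemma cont_at_back r u k n z : cont_at r z -> (forall j, cont_at (fun y => u y j) z) ->
  cont_at (fun y => back (r y) (u y) k n) z.
Proof.
  intros Hr Hu. revert k. induction n as [|n IH]; intros k; cbn [back]; trivial.
  apply cont_at_rot with (al := fun y => 1 - th k (r y)) (be := fun y => - th k (r y)); trivial.
  - intros; apply th_nondeg'.
  - apply cont_at_minus; auto using cont_at_const, cont_at_th.
  - apply cont_at_opp, cont_at_th, Hr.
Qed.

Lemma cont_at_uncarry r u k z : 0 < r z -> cont_at r z ->
  (forall j, cont_at (fun y => u y j) z) ->
  cont_at (fun y => uncarry (r y) (u y) k) z.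
Proof.
  intros Hp Hr Hu.
  (* The number of steps jumps with [r]. One extra step makes the inequality strict, so this fixed
     number serves on a whole neighbourhood. *)
  set (n := S (steps (r z))).
  assert (Hn : 2 < INR n * r z).
  { unfold n. rewrite S_INR. pose proof (steps_large _ Hp). lra. }
  apply cont_at_local with (fun y => back (r y) (u y) k n).
  - assert (H : nb z (fun y => 0 < INR n * r y - 2)).
    { apply (nb_pos (fun y => INR n * r y - 2)); [|lra].
      apply cont_at_minus; [now apply cont_at_scal|apply cont_at_const]. }
    eapply nb_imp; [|apply (nb_and _ _ _ H (nb_pos _ _ Hr Hp))]. cbn beta.
    intros y [H1 H2]. symmetry. apply uncarry_back; trivial. lra.
  - symmetry. apply uncarry_back; trivial. lra.
  - now apply cont_at_back.
Qed.

(** Where [r] vanishes the value is squeezed between 0 and [r]; elsewhere [uncarry] is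
    continuous. *)
Lemma cont_at_fib_mass r u z : (forall y, 0 <= r y) -> (forall y j, Rabs (u y j) <= 1) ->
  cont_at r z -> (forall j, cont_at (fun y => u y j) z) ->
  cont_at (fun y => fib_mass (r y) (u y)) z.
Proof.
  intros Hp Hb Hr Hu. destruct (Req_dec (r z) 0) as [E|E].
  - apply cont_at_squeeze with r; trivial.
    + unfold fib_mass. rewrite E. lra.
    + intros y. pose proof (fib_mass_range (r y) (u y) (Hp y) (Hb y)).
      rewrite Rabs_pos_eq; lra.
  - unfold fib_mass. apply cont_at_div; [lra| |apply cont_at_const].
    apply cont_at_mult; trivial. apply cont_at_plus; [apply cont_at_const|].
    apply cont_at_uncarry; trivial. pose proof (Hp z); lra.
Qed.

Lemma cont_at_fib_rest r u k z : (forall y, 0 <= r y) ->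
  cont_at r z -> (forall j, cont_at (fun y => u y j) z) ->
  cont_at (fun y => fib_rest (r y) (u y) k) z.
Proof.
  intros Hp Hr Hu. destruct (Req_dec (r z) 0) as [E|E].
  - apply cont_at_local with (fun y => u y k); trivial.
    + eapply nb_imp; [|apply (nb_small_scale k r z E Hr)].
      intros y Hy. symmetry. now apply fib_rest_full.
    + symmetry. apply fib_rest_full. rewrite E; lra.
  - apply cont_at_rot with (al := fun y => 1 - th k (r y)) (be := fun y => - th k (r y)); trivial.
    + intros; apply th_nondeg'.
    + apply cont_at_minus; auto using cont_at_const, cont_at_th.
    + apply cont_at_opp, cont_at_th, Hr.
    + apply cont_at_uncarry; trivial. pose proof (Hp z); lra.
Qed.

Lemma cont_at_continuous_R f : (forall z, cont_at f z) -> continuous_R hcube_open f.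
Proof.
  intros H z e He. exists (fun y => Rabs (f y - f z) < e).
  split; [|split; [rewrite Rminus_diag, Rabs_R0; lra|auto]].
  intros x Hx. change (nb x (fun y => Rabs (f y - f z) < e)).
  (* The slack left at [x] is the tolerance that makes this set open. *)
  eapply nb_imp; [|apply (H x (e - Rabs (f x - f z))); lra]. cbn.
  intros y Hy. replace (f y - f z) with ((f y - f x) + (f x - f z)) by ring.
  pose proof (Rabs_triang (f y - f x) (f x - f z)). lra.
Qed.

Lemma cont_at_continuous (F : hcube -> hcube) :
  (forall z k, cont_at (fun y => proj1_sig (F y) k) z) ->
  continuous hcube_open hcube_open F.
Proof.
  intros H V HV x Hx. destruct (HV _ Hx) as (N & e & He & HN).
  change (nb x (fun y => V (F y))).
  apply (nb_imp x (fun y => forall k, (k < N)%nat ->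
    Rabs (proj1_sig (F y) k - proj1_sig (F x) k) < e)); [intros y; apply HN|].
  clear HN. induction N as [|N IH].
  - apply nb_all. intros; lia.
  - eapply nb_imp; [|apply (nb_and _ _ _ IH (H x N e He))]. cbn beta.
    intros y [H1 H2] k Hk. destruct (Nat.eq_dec k N) as [->|]; trivial. apply H1; lia.
Qed.

(** * Cells, masses and means *)

Section Cells.

Variables (T : Type) (x0 : T) (E : nat -> T -> bool).

(** Positive numbers are the nodes of the full binary tree: [xH] is the root,
    [xO p] and [xI p] are the children of [p]. *)
Fixpoint depth (p : positive) : nat :=
  match p with xH => O | xO p' | xI p' => S (depth p') end.

Fixpoint cell (p : positive) (x : T) : bool :=
  match p with
  | xH => true
  | xO p' => cell p' x && E (depth p') x
  | xI p' => cell p' x && negb (E (depth p') x)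
  end.

Definition inhab (p : positive) : Prop := exists x, cell p x = true.

(** An arbitrary point when the cell is empty; such a cell will have mass zero. *)
Definition rep (p : positive) : T := epsilon (inhabits x0) (fun x => cell p x = true).

Lemma cell_rep p : inhab p -> cell p (rep p) = true.
Proof. intros H. unfold rep. now apply epsilon_spec. Qed.

(** Measurability for the finite algebra generated by the first [k] sets, whose atoms are the
    nonempty cells of depth [k]. *)
Definition meas (k : nat) (f : T -> R) : Prop :=
  forall x y, (forall i, (i < k)%nat -> E i x = E i y) -> f x = f y.

Definition simple (f : T -> R) : Prop := exists k, meas k f.

Lemma meas_mono k k' f : (k <= k')%nat -> meas k f -> meas k' f.
Proof. intros H Hf x y Hxy. apply Hf. intros i Hi. apply Hxy. lia. Qed.

Lemma cell_agree p x y : cell p x = true -> cell p y = true ->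
  forall i, (i < depth p)%nat -> E i x = E i y.
Proof.
  induction p as [p IH|p IH|]; cbn; intros Hx Hy i Hi; [| |lia];
    apply andb_true_iff in Hx; apply andb_true_iff in Hy;
    destruct Hx as [Hx Hx'], Hy as [Hy Hy'];
    (destruct (Nat.eq_dec i (depth p)) as [->|]; [|apply IH; trivial; lia]).
  - destruct (E (depth p) x), (E (depth p) y); easy.
  - congruence.
Qed.

Lemma meas_cell_const p f x y : meas (depth p) f ->
  cell p x = true -> cell p y = true -> f x = f y.
Proof. intros Hf Hx Hy. apply Hf. now apply cell_agree. Qed.

Definition indic (p : positive) (x : T) : R := if cell p x then 1 else 0.

Lemma meas_indic p : meas (depth p) (indic p).
Proof.
  intros x y H. unfold indic. replace (cell p y) with (cell p x); trivial.
  induction p as [p IH|p IH|]; cbn in *; trivial;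
    (rewrite IH, (H (depth p)); [easy|lia|intros; apply H; lia]).
Qed.

Lemma simple_indic p : simple (indic p).
Proof. exists (depth p). apply meas_indic. Qed.

Lemma simple_const c : simple (fun _ => c).
Proof. now exists O. Qed.

Lemma simple_common f g : simple f -> simple g -> exists k, meas k f /\ meas k g.
Proof.
  intros [k Hf] [l Hg]. exists (max k l).
  split; [apply (meas_mono k)|apply (meas_mono l)]; trivial; lia.
Qed.

Lemma simple_comp2 (op : R -> R -> R) f g : simple f -> simple g ->
  simple (fun x => op (f x) (g x)).
Proof.
  intros Hf Hg. destruct (simple_common f g Hf Hg) as (k & Hf' & Hg').
  exists k. intros x y H. now rewrite (Hf' x y H), (Hg' x y H).
Qed.

Lemma simple_comp (phi : R -> R) f : simple f -> simple (fun x => phi (f x)).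
Proof. intros H. now apply (simple_comp2 (fun a _ => phi a) f f). Qed.

Lemma simple_lsum {A : Type} (F : A -> T -> R) (L : list A) :
  (forall a, simple (F a)) -> simple (fun x => lsum (fun a => F a x) L).
Proof.
  intros H. induction L as [|a L IH]; cbn; [apply simple_const|].
  now apply (simple_comp2 Rplus).
Qed.

(** * Finitely additive masses and integration of simple functions *)

Record is_mass (m : positive -> R) : Prop := {
  mass_root : m xH = 1;
  mass_split : forall p, m p = m (xO p) + m (xI p);
  mass_ge0 : forall p, 0 <= m p;
  mass_empty : forall p, ~ inhab p -> m p = 0 }.

Lemma mass_or_inhab m p : is_mass m -> inhab p \/ m p = 0.
Proof.
  intros Hm. destruct (classic (inhab p)); [now left|right]. now apply mass_empty.
Qed.

(** A Riemann sum over the descendants of [p] lying [k] levels down, exact once [f] is constant on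
    them. *)
Fixpoint integ (m : positive -> R) (k : nat) (p : positive) (f : T -> R) : R :=
  match k with
  | O => m p * f (rep p)
  | S k' => integ m k' (xO p) f + integ m k' (xI p) f
  end.

Lemma cell_child p x : cell (xO p) x = true \/ cell (xI p) x = true -> cell p x = true.
Proof. cbn. intros [H|H]; now apply andb_true_iff in H. Qed.

Lemma integ_const_on_cell m k p f c : is_mass m ->
  (forall x, cell p x = true -> f x = c) -> integ m k p f = c * m p.
Proof.
  intros Hm. revert p. induction k as [|k IH]; intros p Hf; cbn.
  - destruct (mass_or_inhab m p Hm) as [H| ->]; [|ring].
    rewrite Hf by now apply cell_rep. ring.
  - rewrite !IH by (intros x Hx; apply Hf, cell_child; tauto).
    rewrite (mass_split m Hm p). ring.
Qed.

(** [f] is already constant on the cells [k] levels below [p], and masses are additive. *)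
Lemma integ_level m k p f : is_mass m -> meas (depth p + k) f ->
  integ m (S k) p f = integ m k p f.
Proof.
  intros Hm. revert p. induction k as [|k IH]; intros p Hf.
  - rewrite Nat.add_0_r in Hf.
    assert (H : forall x, cell p x = true -> f x = f (rep p)).
    { intros x Hx. apply (meas_cell_const p f x); trivial. apply cell_rep. now exists x. }
    rewrite !(integ_const_on_cell m _ p f (f (rep p)) Hm H). reflexivity.
  - change (integ m (S (S k)) p f) with (integ m (S k) (xO p) f + integ m (S k) (xI p) f).
    rewrite Nat.add_succ_r in Hf. now rewrite (IH (xO p) Hf), (IH (xI p) Hf).
Qed.

Lemma integ_levels m k k' f : is_mass m -> meas k f -> (k <= k')%nat ->
  integ m k' xH f = integ m k xH f.
Proof.
  intros Hm Hf Hk. induction Hk as [|k' Hk IH]; trivial.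
  rewrite integ_level; trivial. cbn. now apply (meas_mono k).
Qed.

Lemma integ_plus m k p f g :
  integ m k p (fun x => f x + g x) = integ m k p f + integ m k p g.
Proof.
  revert p. induction k as [|k IH]; intros p; cbn; [ring|]. rewrite !IH. ring.
Qed.

Lemma integ_scal m k p c f : integ m k p (fun x => c * f x) = c * integ m k p f.
Proof.
  revert p. induction k as [|k IH]; intros p; cbn; [ring|]. rewrite !IH. ring.
Qed.

Lemma integ_ge0 m k p f : is_mass m -> (forall x, 0 <= f x) -> 0 <= integ m k p f.
Proof.
  intros Hm Hf. revert p. induction k as [|k IH]; intros p; cbn.
  - apply Rmult_le_pos; trivial. now apply mass_ge0.
  - apply Rplus_le_le_0_compat; apply IH.
Qed.

(** On the way from the root down to [p], each sibling subtree contributes zero. *)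
Lemma integ_supp m p k f : is_mass m -> (forall x, cell p x = false -> f x = 0) ->
  integ m (depth p + k) xH f = integ m k p f.
Proof.
  intros Hm. revert k. induction p as [p IH|p IH|]; intros k Hf; trivial; cbn [depth];
    (rewrite Nat.add_succ_comm, IH;
     [cbn [integ]|intros x Hx; apply Hf; cbn; now rewrite Hx]).
  - rewrite (integ_const_on_cell m k (xO p) f 0 Hm); [ring|].
    intros x Hx. apply Hf. cbn in *. apply andb_true_iff in Hx.
    destruct Hx as [-> ->]. easy.
  - rewrite (integ_const_on_cell m k (xI p) f 0 Hm); [ring|].
    intros x Hx. apply Hf. cbn in *. apply andb_true_iff in Hx.
    destruct Hx as [-> Hx]. now destruct (E (depth p) x).
Qed.

(** Choosing the level makes [Int] depend on [f] alone; every admissible level gives the same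
    integral, and for [f] not simple the choice is arbitrary. *)
Definition level (f : T -> R) : nat := epsilon (inhabits O) (fun k => meas k f).

Definition Int (m : positive -> R) (f : T -> R) : R := integ m (level f) xH f.

Lemma Int_integ m k f : is_mass m -> meas k f -> Int m f = integ m k xH f.
Proof.
  intros Hm Hf. unfold Int.
  assert (Hl : meas (level f) f) by (unfold level; apply epsilon_spec; now exists k).
  destruct (Nat.le_ge_cases k (level f)) as [H|H].
  - now apply integ_levels.
  - symmetry. now apply integ_levels.
Qed.

Lemma Int_indic m p : is_mass m -> Int m (indic p) = m p.
Proof.
  intros Hm. rewrite (Int_integ m (depth p)); trivial; [|apply meas_indic].
  rewrite <- (Nat.add_0_r (depth p)), integ_supp; trivial.
  - rewrite (integ_const_on_cell m 0 p (indic p) 1 Hm); [ring|].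
    intros x Hx. unfold indic. now rewrite Hx.
  - intros x Hx. unfold indic. now rewrite Hx.
Qed.

(** Finitely additive probabilities, seen as positive normalised linear functionals; values on
    functions that are not simple are unconstrained. *)
Record is_mean (J : (T -> R) -> R) : Prop := {
  mean_plus : forall f g, simple f -> simple g -> J (fun x => f x + g x) = J f + J g;
  mean_scal : forall c f, simple f -> J (fun x => c * f x) = c * J f;
  mean_ge0 : forall f, simple f -> (forall x, 0 <= f x) -> 0 <= J f;
  mean_one : J (fun _ => 1) = 1 }.

Lemma Int_mean m : is_mass m -> is_mean (Int m).
Proof.
  intros Hm. split.
  - intros f g Hf Hg. destruct (simple_common f g Hf Hg) as (k & Hf' & Hg').
    rewrite !(Int_integ m k); trivial; [apply integ_plus|].
    intros x y H. now rewrite (Hf' x y H), (Hg' x y H).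
  - intros c f [k Hf]. rewrite !(Int_integ m k); trivial; [apply integ_scal|].
    intros x y H. now rewrite (Hf x y H).
  - intros f [k Hf] H. now apply integ_ge0.
  - rewrite (Int_integ m 0); [|trivial|easy]. cbn. rewrite mass_root; trivial. ring.
Qed.

Lemma mean_mass J : is_mean J -> is_mass (fun p => J (indic p)).
Proof.
  intros HJ. split.
  - apply (mean_one J HJ).
  - intros p. rewrite <- (mean_plus J HJ); try apply simple_indic. f_equal.
    apply functional_extensionality. intros x. unfold indic. cbn.
    destruct (cell p x), (E (depth p) x); cbn; lra.
  - intros p. apply (mean_ge0 J HJ); [apply simple_indic|].
    intros x. unfold indic. destruct cell; lra.
  - intros p Hp. replace (indic p) with (fun x : T => 0 * 1).
    + rewrite (mean_scal J HJ); [ring|apply simple_const].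
    + apply functional_extensionality. intros x. unfold indic.
      destruct (cell p x) eqn:Ex; [|ring]. destruct Hp. now exists x.
Qed.

(** Multiply [f] by [indic p] and split along the tree by additivity until [f] is constant on the
    cell, where homogeneity concludes. *)
Lemma mean_integ J k f : is_mean J -> meas k f ->
  J f = integ (fun p => J (indic p)) k xH f.
Proof.
  intros HJ Hf.
  assert (H : forall n p, meas (depth p + n) f ->
    J (fun x => indic p x * f x) = integ (fun p => J (indic p)) n p f).
  { clear k Hf. induction n as [|n IH]; intros p Hf; cbn.
    - rewrite Nat.add_0_r in Hf.
      rewrite Rmult_comm, <- (mean_scal J HJ) by apply simple_indic. f_equal.
      apply functional_extensionality. intros x. unfold indic.
      destruct (cell p x) eqn:Ex; [|ring].
      rewrite (meas_cell_const p f x (rep p) Hf Ex); [ring|].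
      apply cell_rep. now exists x.
    - rewrite <- !IH by (cbn; now rewrite <- Nat.add_succ_r).
      rewrite <- (mean_plus J HJ);
        [|apply (simple_comp2 Rmult); [apply simple_indic|now exists (depth p + S n)%nat]..].
      f_equal. apply functional_extensionality. intros x. unfold indic. cbn.
      destruct (cell p x), (E (depth p) x); cbn; lra. }
  rewrite <- H by trivial. f_equal. apply functional_extensionality.
  intros x. unfold indic. cbn. ring.
Qed.

(** The uniqueness half of the correspondence between means and masses; it allows a pushed-forward
    mean to be stored by its values on cells. *)
Lemma mean_Int J f : is_mean J -> simple f -> J f = Int (fun p => J (indic p)) f.
Proof.
  intros HJ [k Hf]. rewrite (mean_integ J k f HJ Hf). symmetry.
  apply Int_integ; trivial. now apply mean_mass.
Qed.

Lemma mean_minus J f g : is_mean J -> simple f -> simple g ->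
  J (fun x => f x - g x) = J f - J g.
Proof.
  intros HJ Hf Hg. replace (fun x => f x - g x) with (fun x => f x + -1 * g x).
  - rewrite (mean_plus J HJ), (mean_scal J HJ); trivial; [ring|].
    now apply (simple_comp (fun a => -1 * a)).
  - apply functional_extensionality. intros; ring.
Qed.

Lemma mean_le J f g : is_mean J -> simple f -> simple g -> (forall x, f x <= g x) ->
  J f <= J g.
Proof.
  intros HJ Hf Hg H. enough (0 <= J g - J f) by lra. rewrite <- mean_minus; trivial.
  apply (mean_ge0 J HJ); [now apply (simple_comp2 Rminus)|]. intros x. pose proof (H x). lra.
Qed.

Lemma mean_const J c : is_mean J -> J (fun _ => c) = c.
Proof.
  intros HJ. replace (fun _ : T => c) with (fun _ : T => c * 1).
  - rewrite (mean_scal J HJ), (mean_one J HJ) by apply simple_const. ring.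
  - apply functional_extensionality. intros; ring.
Qed.

Lemma mean_abs J f : is_mean J -> simple f -> Rabs (J f) <= J (fun x => Rabs (f x)).
Proof.
  intros HJ Hf. assert (Ha := simple_comp Rabs f Hf).
  assert (H1 : J f <= J (fun x => Rabs (f x))).
  { apply mean_le; trivial. intros x. apply Rle_abs. }
  assert (H2 : J (fun x => -1 * f x) <= J (fun x => Rabs (f x))).
  { apply mean_le; trivial; [now apply (simple_comp (fun a => -1 * a))|].
    intros x. pose proof (Rle_abs (- f x)). rewrite Rabs_Ropp in *. lra. }
  rewrite (mean_scal J HJ) in H2 by trivial. apply Rabs_le. lra.
Qed.

Lemma mean_lsum J {A : Type} (F : A -> T -> R) (L : list A) : is_mean J ->
  (forall a, simple (F a)) ->
  J (fun x => lsum (fun a => F a x) L) = lsum (fun a => J (F a)) L.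
Proof.
  intros HJ HF. induction L as [|a L IH]; cbn; [now apply mean_const|].
  fold (lsum (fun a => J (F a)) L). rewrite <- IH.
  apply (mean_plus J HJ (F a) (fun x => lsum (fun a => F a x) L)); trivial.
  now apply simple_lsum.
Qed.

(** * Coordinates for masses *)

Definition dec (P : Prop) : bool := if excluded_middle_informative P then true else false.

Lemma dec_spec P : reflect P (dec P).
Proof. unfold dec. destruct excluded_middle_informative; now constructor. Qed.

(** Coordinates [u p] in [[-1,1]^N], one sequence per node [p], encode a mass
    distribution together with a residual family [rest u] of sequences: where
    both children of [p] are nonempty, [u p] holds the mass of the left child,
    relative to that of [p]. *)
Definition left_mass (p : positive) (r : R) (z : nat -> R) : R :=
  if dec (inhab (xI p)) then if dec (inhab (xO p)) then fib_mass r z else 0 else r.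

Fixpoint mass (u : positive -> nat -> R) (p : positive) : R :=
  match p with
  | xH => 1
  | xO p' => left_mass p' (mass u p') (u p')
  | xI p' => mass u p' - left_mass p' (mass u p') (u p')
  end.

Definition splits (p : positive) : bool := dec (inhab (xI p)) && dec (inhab (xO p)).

Definition rest (u : positive -> nat -> R) (p : positive) : nat -> R :=
  if splits p then fib_rest (mass u p) (u p) else u p.

(** The inverse of the pair [mass], [rest]. A node with an empty child carries no choice of mass, so
    its sequence is kept unchanged. *)
Definition enc (m : positive -> R) (q : positive -> nat -> R) (p : positive) : nat -> R :=
  if splits p then fib (m p) (m (xO p)) (q p) else q p.

Definition box (u : positive -> nat -> R) : Prop := forall p k, Rabs (u p k) <= 1.

Lemma left_mass_range p r z : 0 <= r -> (forall k, Rabs (z k) <= 1) ->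
  0 <= left_mass p r z <= r.
Proof.
  intros Hr Hz. unfold left_mass.
  destruct (dec (inhab (xI p))), (dec (inhab (xO p))); try lra. now apply fib_mass_range.
Qed.

Lemma mass_pos u p : box u -> 0 <= mass u p.
Proof.
  intros Hu. induction p as [p IH|p IH|]; cbn; [| |lra];
    pose proof (left_mass_range p (mass u p) (u p) IH (Hu p)); lra.
Qed.

Lemma inhab_children p : inhab p -> inhab (xO p) \/ inhab (xI p).
Proof.
  intros [x Hx]. destruct (E (depth p) x) eqn:Ex; [left|right];
    exists x; cbn; now rewrite Hx, Ex.
Qed.

Lemma mass_is_mass u : box u -> is_mass (mass u).
Proof.
  intros Hu. split; trivial.
  - intros p. cbn. ring.
  - intros p. now apply mass_pos.
  (* If only one child is empty, [left_mass] sends everything to the other; if both are, the parent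
     is empty too and has mass zero by induction. *)
  - induction p as [p IH|p IH|]; intros Hp; cbn.
    + unfold left_mass. destruct (dec_spec (inhab (xI p))) as [|_]; [easy|ring].
    + unfold left_mass. destruct (dec_spec (inhab (xI p))) as [H|H].
      * destruct (dec_spec (inhab (xO p))); easy.
      * apply IH. intros H'. apply inhab_children in H'. tauto.
    + destruct Hp. now exists x0.
Qed.

Lemma enc_mass_rest u : box u -> enc (mass u) (rest u) = u.
Proof.
  intros Hu. apply functional_extensionality. intros p.
  apply functional_extensionality. intros k. unfold enc, rest.
  destruct (splits p) eqn:Es; trivial. cbn [mass]. unfold left_mass.
  apply andb_true_iff in Es. destruct Es as [-> ->].
  apply fib_fib_rest. now apply mass_pos.
Qed.

Lemma mass_le_split m p : is_mass m -> 0 <= m (xO p) <= m p.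
Proof.
  intros Hm. pose proof (mass_split m Hm p). pose proof (mass_ge0 m Hm (xO p)).
  pose proof (mass_ge0 m Hm (xI p)). lra.
Qed.

Lemma mass_enc m q : is_mass m -> mass (enc m q) = m.
Proof.
  intros Hm.
  (* Where no choice is stored, an empty child forces [m (xO p)] to be 0 or [m p], as [left_mass]
     prescribes. *)
  assert (Hl : forall p, left_mass p (m p) (enc m q p) = m (xO p)).
  { intros p. unfold left_mass, enc, splits.
    destruct (dec_spec (inhab (xI p))) as [H|H];
      [destruct (dec_spec (inhab (xO p))) as [H'|H']|]; cbn.
    - now apply fib_mass_fib, mass_le_split.
    - symmetry. now apply mass_empty.
    - rewrite (mass_split m Hm p), (mass_empty m Hm (xI p)) by trivial. ring. }
  apply functional_extensionality. intros p. induction p as [p IH|p IH|]; cbn.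
  - rewrite IH, Hl, (mass_split m Hm p). ring.
  - now rewrite IH, Hl.
  - symmetry. now apply mass_root.
Qed.

Lemma rest_enc m q : is_mass m -> rest (enc m q) = q.
Proof.
  intros Hm. unfold rest. rewrite mass_enc by trivial.
  apply functional_extensionality. intros p. unfold enc.
  destruct (splits p); trivial. apply functional_extensionality. intros k.
  apply fib_rest_fib. now apply mass_ge0.
Qed.

Lemma rest_box u : box u -> box (rest u).
Proof.
  intros Hu p k. unfold rest. destruct (splits p); [|apply Hu].
  apply fib_rest_range. apply Hu.
Qed.

Lemma enc_box m q : is_mass m -> box q -> box (enc m q).
Proof.
  intros Hm Hq p k. unfold enc. destruct (splits p); [|apply Hq].
  apply fib_range; [now apply mass_le_split|apply Hq].
Qed.

Section Continuity.

Variables (u : hcube -> positive -> nat -> R) (z : hcube).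
Hypothesis Hb : forall y, box (u y).
Hypothesis Hu : forall p k, cont_at (fun y => u y p k) z.

Lemma cont_at_mass p : cont_at (fun y => mass (u y) p) z.
Proof.
  assert (Hl : forall p, cont_at (fun y => mass (u y) p) z ->
    cont_at (fun y => left_mass p (mass (u y) p) (u y p)) z).
  { clear p. intros p H. unfold left_mass.
    destruct (dec (inhab (xI p))), (dec (inhab (xO p))); trivial;
      [|apply cont_at_const].
    apply cont_at_fib_mass; trivial.
    - intros y. now apply mass_pos.
    - intros y. apply Hb. }
  induction p as [p IH|p IH|]; cbn [mass].
  - apply cont_at_minus; auto.
  - auto.
  - apply cont_at_const.
Qed.

Lemma cont_at_rest p k : cont_at (fun y => rest (u y) p k) z.
Proof.
  unfold rest. destruct (splits p); trivial.
  apply cont_at_fib_rest; auto using cont_at_mass. intros y. now apply mass_pos.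
Qed.

(** The level depends on [f] only, so the integral is a fixed finite linear combination of
    masses. *)
Lemma cont_at_Int f : cont_at (fun y => Int (mass (u y)) f) z.
Proof.
  unfold Int. generalize (level f), xH. intros n. induction n as [|n IH]; intros p; cbn.
  - apply cont_at_mult; [apply cont_at_mass|apply cont_at_const].
  - now apply cont_at_plus.
Qed.

End Continuity.

End Cells.

Arguments simple {T} E f.
Arguments indic {T} E p x.
Arguments is_mass {T} E m.
Arguments is_mean {T} E J.
Arguments Int {T} x0 E m f.
Arguments mass {T} E u p.
Arguments rest {T} E u p.
Arguments enc {T} E m q p.

(** * The action on the cube *)

(** The Cantor pairing splits the index of the cube into a node and a position; [[0,1]] is rescaled
    to [[-1,1]]. *)
Definition coords (z : hcube) (p : positive) (k : nat) : R :=
  2 * proj1_sig z (Cantor.to_nat (pred (Pos.to_nat p), k)) - 1.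

Lemma coords_box z : box (coords z).
Proof.
  intros p k. unfold coords. destruct (proj2_sig z (to_nat (pred (Pos.to_nat p), k))).
  apply Rabs_le. lra.
Qed.

Lemma cont_at_coords z p k : cont_at (fun y => coords y p k) z.
Proof.
  apply cont_at_minus; [apply cont_at_scal, cont_at_coord|apply cont_at_const].
Qed.

Definition uncoords (u : positive -> nat -> R) (n : nat) : R :=
  (1 + u (Pos.of_succ_nat (fst (Cantor.of_nat n))) (snd (Cantor.of_nat n))) / 2.

Lemma uncoords_range u : box u -> forall n, 0 <= uncoords u n <= 1.
Proof.
  intros Hu n. unfold uncoords.
  pose proof (Hu (Pos.of_succ_nat (fst (of_nat n))) (snd (of_nat n))) as H.
  revert H. unfold Rabs. destruct Rcase_abs; lra.
Qed.

Definition cube_of (u : positive -> nat -> R) (Hu : box u) : hcube :=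
  exist _ (uncoords u) (uncoords_range u Hu).

Lemma coords_cube_of u Hu : coords (cube_of u Hu) = u.
Proof.
  apply functional_extensionality. intros p. apply functional_extensionality. intros k.
  unfold coords, cube_of, uncoords. cbn [proj1_sig].
  rewrite Cantor.cancel_of_to. cbn [fst snd].
  replace (Pos.of_succ_nat (pred (Pos.to_nat p))) with p; [field|].
  apply Pos2Nat.inj. rewrite SuccNat2Pos.id_succ.
  pose proof (Pos2Nat.is_pos p). lia.
Qed.

Lemma coords_inj y z : coords y = coords z -> y = z.
Proof.
  intros H. apply eq_sig_hprop; [intros; apply proof_irrelevance|].
  apply functional_extensionality. intros n.
  assert (Hn := f_equal (fun u => u (Pos.of_succ_nat (fst (of_nat n))) (snd (of_nat n))) H).
  cbn beta in Hn. unfold coords in Hn. rewrite SuccNat2Pos.id_succ in Hn. cbn [pred] in Hn.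
  rewrite <- surjective_pairing, Cantor.cancel_to_of in Hn. lra.
Qed.

Section Action.

Variables (G : group) (E : nat -> G -> bool).
Hypothesis E_shift : forall (g : G) i, exists j, forall x, E j x = E i (gmul G g x).

Definition shift (g : G) (f : G -> R) (x : G) : R := f (gmul G g x).

(** The finitely many translated sets that are needed have indices below a common bound. *)
Lemma simple_shift g f : simple E f -> simple E (shift g f).
Proof.
  intros [k Hf].
  assert (H : exists k', forall i, (i < k)%nat -> exists j, (j < k')%nat /\
    forall x, E j x = E i (gmul G g x)).
  { clear Hf. induction k as [|k [k' IH]].
    - exists O. intros; lia.
    - destruct (E_shift g k) as [j Hj]. exists (S (max k' j)). intros i Hi.
      destruct (Nat.eq_dec i k) as [->|].
      + exists j. split; [lia|trivial].
      + destruct (IH i) as (j' & Hj' & H); [lia|]. exists j'. split; [lia|trivial]. }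
  destruct H as [k' Hk']. exists k'. intros x y Hxy. apply Hf. intros i Hi.
  destruct (Hk' i Hi) as (j & Hj & HE). rewrite <- !HE. auto.
Qed.

Definition push (g : G) (J : (G -> R) -> R) (f : G -> R) : R := J (shift g f).

Lemma push_mean g J : is_mean E J -> is_mean E (push g J).
Proof.
  intros HJ. split; unfold push.
  - intros f f' Hf Hf'. apply (mean_plus _ _ J HJ (shift g f) (shift g f'));
      now apply simple_shift.
  - intros c f Hf. apply (mean_scal _ _ J HJ c (shift g f)). now apply simple_shift.
  - intros f Hf H. apply (mean_ge0 _ _ J HJ); [now apply simple_shift|].
    intros x. apply H.
  - apply (mean_one _ _ J HJ).
Qed.

Definition mean_of (u : positive -> nat -> R) : (G -> R) -> R := Int (gone G) E (mass E u).

Lemma mean_of_mean u : box u -> is_mean E (mean_of u).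
Proof. intros Hu. apply Int_mean, mass_is_mass; trivial. exact (gone G). Qed.

Definition move_mass (g : G) (u : positive -> nat -> R) (p : positive) : R :=
  push g (mean_of u) (indic E p).

(** The action on [K x [-1,1]^N] read in coordinates: the mean is pushed forward and the residual
    sequences stay. *)
Definition move (g : G) (u : positive -> nat -> R) : positive -> nat -> R :=
  enc E (move_mass g u) (rest E u).

Lemma move_mass_is_mass g u : box u -> is_mass E (move_mass g u).
Proof. intros Hu. apply (mean_mass _ _ (push g (mean_of u))), push_mean, mean_of_mean, Hu. Qed.

Lemma move_box g u : box u -> box (move g u).
Proof.
  intros Hu. apply enc_box; [now apply move_mass_is_mass|now apply rest_box].
Qed.

(** Decoding the moved coordinates gives back the pushed-forward masses, and these determine the
    mean. *)
Lemma mean_of_move g u f : box u -> simple E f ->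
  mean_of (move g u) f = mean_of u (shift g f).
Proof.
  intros Hu Hf. unfold mean_of at 1, move. rewrite mass_enc by now apply move_mass_is_mass.
  symmetry. apply (mean_Int _ (gone G) _ (push g (mean_of u))); trivial.
  now apply push_mean, mean_of_mean.
Qed.

Lemma shift_one f : shift (gone G) f = f.
Proof.
  apply functional_extensionality. intros x. unfold shift. now rewrite gmul1l.
Qed.

Lemma shift_mul g h f : shift (gmul G g h) f = shift h (shift g f).
Proof.
  apply functional_extensionality. intros x. unfold shift. now rewrite gmulA.
Qed.

Lemma move_one u : box u -> move (gone G) u = u.
Proof.
  intros Hu. unfold move. rewrite <- (enc_mass_rest _ E u Hu) at 3. f_equal.
  apply functional_extensionality. intros p. unfold move_mass, push.
  rewrite shift_one. apply Int_indic, mass_is_mass; trivial. exact (gone G).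
Qed.

Lemma move_mul g h u : box u -> move (gmul G g h) u = move g (move h u).
Proof.
  intros Hu. unfold move at 1 2.
  replace (rest E (move h u)) with (rest E u)
    by (symmetry; apply rest_enc; now apply move_mass_is_mass).
  f_equal. apply functional_extensionality. intros p. unfold move_mass, push.
  rewrite mean_of_move, shift_mul; trivial. apply simple_shift, simple_indic.
Qed.

Definition cube_act (g : G) (z : hcube) : hcube :=
  cube_of (move g (coords z)) (move_box g _ (coords_box z)).

Lemma coords_act g z : coords (cube_act g z) = move g (coords z).
Proof. apply coords_cube_of. Qed.

Lemma cont_at_mean_of f z : cont_at (fun y => mean_of (coords y) f) z.
Proof.
  apply cont_at_Int; [intros; apply coords_box|intros; apply cont_at_coords].
Qed.

Lemma cont_at_move g z p k : cont_at (fun y => move g (coords y) p k) z.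
Proof.
  assert (Hr : forall p k, cont_at (fun y => rest E (coords y) p k) z).
  { intros. apply cont_at_rest; [intros; apply coords_box|intros; apply cont_at_coords]. }
  unfold move, enc. destruct splits; trivial.
  apply cont_at_fib; trivial; try apply cont_at_mean_of.
  intros y. eapply mass_ge0. apply move_mass_is_mass, coords_box.
Qed.

Lemma cube_act_is_action : is_action G hcube_open cube_act.
Proof.
  split; [|split].
  - intros z. apply coords_inj. rewrite coords_act. apply move_one, coords_box.
  - intros g h z. apply coords_inj. rewrite !coords_act. apply move_mul, coords_box.
  - intros g. apply cont_at_continuous. intros z n. cbn. unfold uncoords.
    apply cont_at_div; [lra| |apply cont_at_const].
    apply cont_at_plus; [apply cont_at_const|apply cont_at_move].
Qed.

(** A mean carries the [beta n x] to their barycentre, so that the maps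
    [beta n] extend from points of [G] to the whole cube. *)
Lemma cube_act_amenable (beta : nat -> G -> G -> R) :
  (forall n x, is_prob (beta n x)) ->
  (forall n h, simple E (fun x => beta n x h)) ->
  (forall n, exists L, NoDup L /\ forall x, lsum (beta n x) L = 1) ->
  (forall (g : G) eps, eps > 0 -> exists N : nat, forall n, (N <= n)%nat ->
     forall x L, NoDup L ->
     lsum (fun h => Rabs (transl G g (beta n x) h - beta n (gmul G g x) h)) L <= eps) ->
  amenable_action G hcube_open cube_act.
Proof.
  intros Hp Hs Hf Ha.
  assert (HJ : forall z, is_mean E (mean_of (coords z))).
  { intros z. apply mean_of_mean, coords_box. }
  exists (fun n z h => mean_of (coords z) (fun x => beta n x h)).
  split; [|split].
  - intros n z. split; [|split].
    + intros h. split.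
      * apply (mean_ge0 _ _ _ (HJ z)); trivial. intros x. apply (Hp n x).
      * rewrite <- (mean_const _ _ _ 1 (HJ z)).
        apply mean_le with E; trivial; [apply simple_const|]. intros x. apply (Hp n x).
    + intros L HL. rewrite <- (mean_lsum _ E _ (fun h x => beta n x h)) by trivial.
      rewrite <- (mean_const _ _ _ 1 (HJ z)).
      apply mean_le with E; trivial;
        [now apply (simple_lsum _ _ (fun h x => beta n x h))|apply simple_const|].
      intros x. now apply (Hp n x).
    (* Means are only finitely additive; the common finite support makes the total mass a finite
       sum, which commutes with the mean. *)
    + intros e He. destruct (Hf n) as (L & HL & H1). exists L. split; trivial.
      rewrite <- (mean_lsum _ E _ (fun h x => beta n x h)) by trivial.
      replace (fun x => lsum (fun h => beta n x h) L) with (fun _ : G => 1).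
      * rewrite (mean_const _ _ _ 1 (HJ z)). lra.
      * apply functional_extensionality. intros x. symmetry. apply H1.
  - intros n h. apply cont_at_continuous_R. intros z. apply cont_at_mean_of.
  - intros g e He. destruct (Ha g e He) as [N HN]. exists N. intros n Hn z L HL.
    (* The defect on the cube is the mean of [D]. By [mean_abs] its absolute value is at most the
       mean of that of [D], and [HN] bounds the sum pointwise inside the mean. *)
    pose (D := fun h x => transl G g (beta n x) h - beta n (gmul G g x) h).
    assert (HD : forall h, simple E (D h)).
    { intros h. apply (simple_comp2 _ E Rminus); [apply Hs|].
      apply (simple_shift g (fun x => beta n x h)), Hs. }
    apply Rle_trans with (lsum (fun h => mean_of (coords z) (fun x => Rabs (D h x))) L).
    + clear HL. induction L as [|h L IH]; cbn; [lra|].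
      apply Rplus_le_compat; [|apply IH].
      rewrite coords_act, mean_of_move; trivial; [|apply coords_box].
      unfold transl. rewrite <- (mean_minus _ E);
        trivial; [|now apply (simple_shift g (fun x => beta n x h))].
      apply (mean_abs _ E); trivial. apply HD.
    + rewrite <- (mean_lsum _ E _ (fun h x => Rabs (D h x)));
        trivial; [|intros h; now apply (simple_comp _ E Rabs)].
      rewrite <- (mean_const _ _ _ e (HJ z)).
      apply mean_le with E; trivial;
        [|apply simple_const|intros x; now apply HN].
      apply (simple_lsum _ _ (fun h x => Rabs (D h x))).
      intros h; now apply (simple_comp _ E Rabs).
Qed.

End Action.

(** * Discretization of an amenable action *)

Lemma classic_eq_dec {A : Type} (x y : A) : {x = y} + {x <> y}.
Proof. apply excluded_middle_informative. Qed.

(** * Finite sums *)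

Section Sums.

Context {A : Type}.
Implicit Types (f g : A -> R) (L : list A).

Lemma lsum_plus f g L : lsum (fun a => f a + g a) L = lsum f L + lsum g L.
Proof.
  unfold lsum. induction L as [|a L IH]; cbn; [ring|]. rewrite IH. ring.
Qed.

Lemma lsum_scal c f L : lsum (fun a => c * f a) L = c * lsum f L.
Proof.
  unfold lsum. induction L as [|a L IH]; cbn; [ring|]. rewrite IH. ring.
Qed.

Lemma lsum_minus f g L : lsum (fun a => f a - g a) L = lsum f L - lsum g L.
Proof.
  unfold lsum. induction L as [|a L IH]; cbn; [ring|]. rewrite IH. ring.
Qed.

Lemma lsum_le f g L : (forall a, In a L -> f a <= g a) -> lsum f L <= lsum g L.
Proof.
  unfold lsum. induction L as [|a L IH]; cbn; intros H; [lra|].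
  apply Rplus_le_compat; auto.
Qed.

Lemma lsum_ge0 f L : (forall a, 0 <= f a) -> 0 <= lsum f L.
Proof.
  intros H. unfold lsum. induction L as [|a L IH]; cbn; [lra|]. pose proof (H a). lra.
Qed.

Lemma lsum_mid f L1 a L2 : lsum f (L1 ++ a :: L2) = f a + lsum f (L1 ++ L2).
Proof.
  unfold lsum. induction L1 as [|b L1 IH]; cbn; [ring|]. rewrite IH. ring.
Qed.

Lemma lsum_map {B : Type} (s : B -> A) f (L : list B) :
  lsum f (map s L) = lsum (fun b => f (s b)) L.
Proof. unfold lsum. induction L as [|b L IH]; cbn; [trivial|]. now rewrite IH. Qed.

Lemma lsum_supp f L L' : (forall a, 0 <= f a) -> NoDup L ->
  (forall a, In a L -> f a <> 0 -> In a L') -> lsum f L <= lsum f L'.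
Proof.
  intros Hf. revert L'. induction L as [|a L IH]; intros L' HL Hi.
  - now apply lsum_ge0.
  - apply NoDup_cons_iff in HL. destruct HL as [Ha HL]. cbn. fold (lsum f L).
    destruct (Req_dec (f a) 0) as [E|E].
    + rewrite E, Rplus_0_l. apply IH; trivial. intros b Hb. apply Hi. now right.
    + destruct (in_split a L') as (L1 & L2 & ->); [apply Hi; trivial; now left|].
      rewrite lsum_mid. apply Rplus_le_compat_l, IH; trivial.
      intros b Hb Hb0. assert (H : In b (L1 ++ a :: L2)) by (apply Hi; trivial; now right).
      apply in_app_iff in H. apply in_app_iff.
      destruct H as [H|[->|H]]; [now left|easy|now right].
Qed.

Definition delta (o a : A) : R := if classic_eq_dec a o then 1 else 0.

Lemma delta_ge0 o a : 0 <= delta o a.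
Proof. unfold delta. destruct classic_eq_dec; lra. Qed.

Lemma delta_same o : delta o o = 1.
Proof. unfold delta. now destruct classic_eq_dec. Qed.

Lemma lsum_delta o L : NoDup L -> lsum (delta o) L <= 1.
Proof.
  intros HL. replace 1 with (lsum (delta o) (o :: nil)).
  - apply lsum_supp; trivial; [apply delta_ge0|]. intros a _. unfold delta.
    destruct classic_eq_dec as [->|]; [now left|easy].
  - cbn. rewrite delta_same. ring.
Qed.

Lemma lsum_delta_in o L : In o L -> 1 <= lsum (delta o) L.
Proof.
  intros Ho. replace 1 with (lsum (delta o) (o :: nil)).
  - apply lsum_supp; [apply delta_ge0|repeat constructor; easy|]. intros a [<-|[]]; auto.
  - cbn. rewrite delta_same. ring.
Qed.

End Sums.

(** The integral part of [s], provided that [0 <= s <= N]. *)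
Fixpoint rcount (N : nat) (s : R) : R :=
  match N with
  | O => 0
  | S c => rcount c s + (if dec (INR (S c) <= s) then 1 else 0)
  end.

Lemma rcount_spec N s : 0 <= s ->
  0 <= rcount N s <= s /\ rcount N s <= INR N /\ (rcount N s = INR N \/ s < rcount N s + 1).
Proof.
  intros Hs. induction N as [|N IH]; [cbn; lra|].
  cbn [rcount]. destruct (dec_spec (INR (S N) <= s)) as [H|H]; rewrite S_INR in *; lra.
Qed.

(** * Rounding a probability to a finite grid *)

Section Quantize.

Context {A : Type} (o : A) (F : list A) (N : nat).
Hypotheses (HF : NoDup F) (HN : (0 < N)%nat).

Definition quant (a : A -> R) (h : A) : R :=
  if in_dec classic_eq_dec h F then / INR N * rcount N (INR N * a h) else 0.

(** Round down to multiples of [1/N] on [F] and put the lost mass on [o]. *)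
Definition discr (a : A -> R) (h : A) : R :=
  quant a h + (1 - lsum (quant a) F) * delta o h.

Variable a : A -> R.
Hypothesis Ha : is_prob a.

Lemma quant_spec h : 0 <= quant a h <= a h /\ (In h F -> a h - / INR N <= quant a h).
Proof.
  destruct Ha as [Hr _]. specialize (Hr h). unfold quant.
  assert (Hp := lt_0_INR N HN). assert (Hi := Rinv_0_lt_compat _ Hp).
  assert (H : a h = / INR N * (INR N * a h)) by (field; lra).
  destruct in_dec as [Hh|Hh]; [|split; [lra|easy]].
  destruct (rcount_spec N (INR N * a h)) as (H1 & H2 & H3); [nra|].
  assert (H4 : INR N * a h <= rcount N (INR N * a h) + 1) by nra.
  split; [split|intros _].
  - apply Rmult_le_pos; lra.
  - rewrite H at 2. apply Rmult_le_compat_l; lra.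
  - rewrite H at 1. apply (Rmult_le_compat_l (/ INR N)) in H4; lra.
Qed.

Lemma quant_lsum_le L : NoDup L -> lsum (quant a) L <= lsum (quant a) F.
Proof.
  intros HL. apply lsum_supp; trivial; [intros; apply quant_spec|].
  intros h _. unfold quant. destruct in_dec; easy.
Qed.

Lemma quant_lsum_ge L : incl F L -> lsum (quant a) F <= lsum (quant a) L.
Proof. intros HL. apply lsum_supp; trivial; [intros; apply quant_spec|auto]. Qed.

Lemma quant_mass_le1 : lsum (quant a) F <= 1.
Proof.
  apply Rle_trans with (lsum a F); [apply lsum_le; intros; apply quant_spec|now apply Ha].
Qed.

Lemma quant_mass_ge e : 1 - e <= lsum a F -> 1 - e - INR (length F) * / INR N <= lsum (quant a) F.
Proof.
  intros H. enough (lsum a F - INR (length F) * / INR N <= lsum (quant a) F) by lra.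
  assert (Hi := Rinv_0_lt_compat _ (lt_0_INR N HN)).
  apply Rle_trans with (lsum (fun h => a h - / INR N) F);
    [|apply lsum_le; intros; now apply quant_spec].
  rewrite lsum_minus. apply Rplus_le_compat_l, Ropp_le_contravar.
  clear. induction F as [|h L IH]; [cbn; lra|].
  cbn [length]. rewrite S_INR. cbn. fold (lsum (fun _ : A => / INR N) L). lra.
Qed.

Lemma discr_lsum L :
  lsum (discr a) L = lsum (quant a) L + (1 - lsum (quant a) F) * lsum (delta o) L.
Proof.
  unfold discr. rewrite lsum_plus, lsum_scal. reflexivity.
Qed.

Lemma discr_le1 L : NoDup L -> lsum (discr a) L <= 1.
Proof.
  intros HL. rewrite discr_lsum. pose proof (quant_lsum_le L HL).
  pose proof (lsum_delta o L HL). pose proof quant_mass_le1. nra.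
Qed.

Lemma discr_ge_quant h : quant a h <= discr a h.
Proof.
  unfold discr. pose proof (delta_ge0 o h). pose proof quant_mass_le1. nra.
Qed.

Lemma discr_total L : NoDup L -> incl (o :: F) L -> lsum (discr a) L = 1.
Proof.
  intros HL Hi. apply Rle_antisym; [now apply discr_le1|]. rewrite discr_lsum.
  pose proof (quant_lsum_ge L (fun h Hh => Hi h (or_intror Hh))).
  pose proof (lsum_delta_in o L (Hi o (or_introl eq_refl))).
  pose proof quant_mass_le1. nra.
Qed.

Lemma discr_prob : is_prob (discr a).
Proof.
  split; [|split].
  - intros h. split.
    + pose proof (discr_ge_quant h). pose proof (proj1 (quant_spec h)). lra.
    + replace (discr a h) with (lsum (discr a) (h :: nil)) by (cbn; ring).
      apply discr_le1. repeat constructor. easy.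
  - apply discr_le1.
  - intros e He. exists (nodup classic_eq_dec (o :: F)). split; [apply NoDup_nodup|].
    rewrite discr_total; [lra|apply NoDup_nodup|]. intros h Hh. now apply nodup_In.
Qed.

(** Both [discr a] and [a] dominate [quant a], and each exceeds it by total mass at most
    [1 - lsum (quant a) F]. *)
Lemma discr_dist L : NoDup L ->
  lsum (fun h => Rabs (discr a h - a h)) L <= 2 * (1 - lsum (quant a) F).
Proof.
  intros HL.
  apply Rle_trans with (lsum (fun h => (discr a h - quant a h) + (a h - quant a h)) L).
  - apply lsum_le. intros h _. pose proof (discr_ge_quant h).
    pose proof (proj1 (quant_spec h)). apply Rabs_le. lra.
  - rewrite lsum_plus, !lsum_minus, discr_lsum.
    assert (H : lsum (fun h => a h - quant a h) L <= 1 - lsum (quant a) F).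
    { set (L' := nodup classic_eq_dec (L ++ F)).
      assert (HL' : NoDup L') by apply NoDup_nodup.
      apply Rle_trans with (lsum (fun h => a h - quant a h) L').
      - apply lsum_supp; trivial.
        + intros h. pose proof (proj1 (quant_spec h)). lra.
        + intros h Hh _. apply nodup_In, in_app_iff. now left.
      - rewrite lsum_minus. apply Rplus_le_compat; [now apply Ha|].
        apply Ropp_le_contravar, quant_lsum_ge. intros h Hh.
        apply nodup_In, in_app_iff. now right. }
    rewrite lsum_minus in H. pose proof (lsum_delta o L HL). pose proof quant_mass_le1. nra.
Qed.

End Quantize.

(** * Uniform tightness over a compact space *)

Section Tightness.

Context {X A : Type} (op : (X -> Prop) -> Prop) (b : X -> A -> R).
Hypotheses (Hop : is_topology op) (Hb : forall x, is_prob (b x))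
  (Hc : forall h, continuous_R op (fun x => b x h)).

Lemma continuous_R_lsum L : continuous_R op (fun x => lsum (b x) L).
Proof.
  induction L as [|h L IH]; intros x e He.
  - exists (fun _ => True). split; [apply Hop|split; trivial]. intros y _. cbn.
    rewrite Rminus_diag, Rabs_R0. lra.
  - destruct (Hc h x (e / 2) ltac:(lra)) as (U & HU & Ux & H1).
    destruct (IH x (e / 2) ltac:(lra)) as (V & HV & Vx & H2).
    exists (fun y => U y /\ V y). split; [now apply Hop|split; [easy|]].
    intros y [Uy Vy]. specialize (H1 y Uy). specialize (H2 y Vy).
    change (Rabs ((b y h + lsum (b y) L) - (b x h + lsum (b x) L)) < e).
    replace ((b y h + lsum (b y) L) - (b x h + lsum (b x) L))
      with ((b y h - b x h) + (lsum (b y) L - lsum (b x) L)) by ring.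
    pose proof (Rabs_triang (b y h - b x h) (lsum (b y) L - lsum (b x) L)). lra.
Qed.

(** A finite list carrying more than [1 - e / 2] at a point still carries [1 - e] nearby; the lists
    of a finite subcover are merged. *)
Lemma compact_tight e : Defs.compact op -> e > 0 ->
  exists L, NoDup L /\ forall x, 1 - e <= lsum (b x) L.
Proof.
  intros HX He.
  destruct (HX {LU : list A * (X -> Prop) | op (snd LU) /\ NoDup (fst LU) /\
      forall y, snd LU y -> 1 - e <= lsum (b y) (fst LU)}
    (fun i => snd (proj1_sig i))) as [Is HIs].
  - intros i. apply (proj2_sig i).
  - intros x. destruct (proj2 (proj2 (Hb x)) (e / 2) ltac:(lra)) as (L & HL & H).
    destruct (continuous_R_lsum L x (e / 2) ltac:(lra)) as (U & HU & Ux & HUL).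
    unshelve eexists (exist _ (L, U) _); cbn [proj1_sig fst snd]; trivial. repeat split; trivial.
    intros y Uy. specialize (HUL y Uy). apply Rabs_def2 in HUL. lra.
  - exists (nodup classic_eq_dec (flat_map (fun i => fst (proj1_sig i)) Is)).
    split; [apply NoDup_nodup|]. intros x. destruct (HIs x) as (i & Hi & Hx).
    destruct (proj2_sig i) as (_ & HL & H).
    apply Rle_trans with (lsum (b x) (fst (proj1_sig i))); [now apply H|].
    apply lsum_supp; trivial; [intros; apply Hb|].
    intros h Hh _. apply nodup_In, in_flat_map. now exists i.
Qed.

End Tightness.

Lemma gcancel (G : group) (g x y : G) : gmul G g x = gmul G g y -> x = y.
Proof.
  intros H. rewrite <- (gmul1l G x), <- (gmul1l G y), <- (gmulVl G g), <- !gmulA.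
  now rewrite H.
Qed.

(** Rounded values depend on [a n x] only through threshold events; those for all stages, points and
    thresholds, with all translates, still form a countable family. *)
Lemma coarse_discretization (G : group) (a : nat -> G -> G -> R) : countable_group G ->
  (forall n x, is_prob (a n x)) ->
  (forall n e, e > 0 -> exists L, NoDup L /\ forall x, 1 - e <= lsum (a n x) L) ->
  (forall (g : G) eps, eps > 0 -> exists N : nat, forall n, (N <= n)%nat ->
     forall x L, NoDup L ->
     lsum (fun h => Rabs (transl G g (a n x) h - a n (gmul G g x) h)) L <= eps) ->
  exists (E : nat -> G -> bool) (beta : nat -> G -> G -> R),
  (forall (g : G) i, exists j, forall x, E j x = E i (gmul G g x)) /\
  (forall n x, is_prob (beta n x)) /\
  (forall n h, simple E (fun x => beta n x h)) /\
  (forall n, exists L, NoDup L /\ forall x, lsum (beta n x) L = 1) /\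
  (forall (g : G) eps, eps > 0 -> exists N : nat, forall n, (N <= n)%nat ->
     forall x L, NoDup L ->
     lsum (fun h => Rabs (transl G g (beta n x) h - beta n (gmul G g x) h)) L <= eps).
Proof.
  intros [e He] Ha Ht Heq.
  assert (Hpos : forall n, 0 < / INR (S n)).
  { intros n. apply Rinv_0_lt_compat, lt_0_INR. lia. }
  destruct (choice (fun n L => NoDup L /\ forall x, 1 - / INR (S n) <= lsum (a n x) L)) as [F HF].
  { intros n. apply Ht, Hpos. }
  (* This grid is fine enough for rounding on [F n] to lose at most [1/(n+1)] in total. *)
  pose (N := fun n => (S n * S (length (F n)))%nat).
  assert (HN : forall n, (0 < N n)%nat) by (intros n; unfold N; lia).
  pose (beta := fun n x => discr (gone G) (F n) (N n) (a n x)).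
  (* The index codes a translation [e c1], a stage [n], a point [e c2] and a threshold [c + 1]. *)
  pose (E := fun i x =>
    let '(c1, j1) := Cantor.of_nat i in let '(n, j2) := Cantor.of_nat j1 in
    let '(c2, c) := Cantor.of_nat j2 in
    dec (INR (S c) <= INR (N n) * a n (gmul G (e c1) x) (e c2))).
  assert (HE : forall c1 n c2 c x,
    E (to_nat (c1, to_nat (n, to_nat (c2, c)))) x =
    dec (INR (S c) <= INR (N n) * a n (gmul G (e c1) x) (e c2))).
  { intros. unfold E. now rewrite !cancel_of_to. }
  (* The tail outside [F n] and the rounding each cost at most [1/(n+1)], and [discr_dist] doubles
     their sum. *)
  assert (Hdist : forall n x L, NoDup L ->
    lsum (fun h => Rabs (beta n x h - a n x h)) L <= 4 * / INR (S n)).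
  { intros n x L HL. destruct (HF n) as [HFn HFx].
    eapply Rle_trans; [apply discr_dist; auto|].
    pose proof (quant_mass_ge (F n) (N n) (HN n) (a n x) (Ha n x) _ (HFx x)) as H.
    assert (H' : INR (length (F n)) * / INR (N n) <= / INR (S n)).
    { unfold N. rewrite mult_INR, Rinv_mult.
      assert (INR (length (F n)) * / INR (S (length (F n))) <= 1).
      { apply Rmult_le_reg_r with (INR (S (length (F n)))); [apply lt_0_INR; lia|].
        rewrite Rmult_assoc, Rinv_l, S_INR; [lra|]. apply not_0_INR. lia. }
      pose proof (Hpos n). nra. }
    lra. }
  exists E, beta. split; [|split; [|split; [|split]]].
  (* Translating by [g] replaces [e c1] by its product with [g], again in the enumeration. *)
  - intros g i. destruct (of_nat i) as [c1 j1] eqn:E1.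
    destruct (of_nat j1) as [n j2] eqn:E2. destruct (of_nat j2) as [c2 c] eqn:E3.
    destruct (He (gmul G (e c1) g)) as [c1' Hc1'].
    exists (to_nat (c1', to_nat (n, to_nat (c2, c)))). intros x. rewrite HE, Hc1'.
    unfold E. now rewrite E1, E2, E3, gmulA.
  - intros n x. apply discr_prob; auto. apply HF.
  - intros n h.
    assert (Hq : forall h, simple E (fun x => quant (F n) (N n) (a n x) h)).
    { clear h. intros h. unfold quant. destruct in_dec; [|apply simple_const].
      apply (simple_comp _ _ (Rmult (/ INR (N n)))).
      enough (H : forall M, simple E (fun x => rcount M (INR (N n) * a n x h))) by apply H.
      induction M as [|c IH]; cbn [rcount]; [apply simple_const|].
      apply (simple_comp2 _ _ Rplus); trivial.
      (* Each summand of [rcount] is the indicator of one of the sets [E], the one with trivial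
         translation. *)
      destruct (He (gone G)) as [c1 Hc1]. destruct (He h) as [c2 Hc2].
      exists (S (to_nat (c1, to_nat (n, to_nat (c2, c))))). intros x y Hxy.
      specialize (Hxy _ (Nat.lt_succ_diag_r _)). rewrite !HE, Hc1, Hc2, !gmul1l in Hxy.
      now rewrite Hxy. }
    apply (simple_comp2 _ _ Rplus); trivial.
    apply (simple_comp _ _ (fun s => (1 - s) * delta (gone G) h)
      (fun x => lsum (quant (F n) (N n) (a n x)) (F n))).
    now apply (simple_lsum _ _ (fun h x => quant (F n) (N n) (a n x) h)).
  - intros n. exists (nodup classic_eq_dec (gone G :: F n)). split; [apply NoDup_nodup|].
    intros x. apply discr_total; auto; [apply HF|apply NoDup_nodup|].
    intros h Hh. now apply nodup_In.
  - intros g eps Heps. destruct (Heq g (eps / 2) ltac:(lra)) as [N1 HN1].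
    (* Two rounding errors of [4/(n+1) <= eps/4] and a defect of [eps/2] add up to [eps]. *)
    destruct (archimed_cor1 (eps / 16) ltac:(lra)) as (N2 & HN2 & HN2').
    exists (max N1 N2). intros n Hn x L HL.
    assert (Hinv : / INR (S n) <= eps / 16).
    { apply Rlt_le, Rle_lt_trans with (/ INR N2); trivial.
      apply Rinv_le_contravar; [now apply lt_0_INR|]. apply le_INR. lia. }
    specialize (HN1 n ltac:(lia) x L HL).
    (* The rounding error of the translated term is a sum over [map s L], still without
       duplicates. *)
    pose (s := fun h => gmul G (ginv G g) h).
    assert (HsL : NoDup (map s L)).
    { apply FinFun.Injective_map_NoDup; trivial. intros h h'. apply gcancel. }
    pose proof (Hdist n x (map s L) HsL) as H1. rewrite lsum_map in H1.
    pose proof (Hdist n (gmul G g x) L HL) as H2.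
    eapply Rle_trans; [|apply Rle_trans with (4 * / INR (S n) + eps / 2 + 4 * / INR (S n)); [|lra]].
    2: { apply Rplus_le_compat; [apply Rplus_le_compat|]; [exact H1|exact HN1|exact H2]. }
    rewrite <- !lsum_plus. apply lsum_le. intros h _. unfold transl. fold (s h).
    replace (beta n x (s h) - beta n (gmul G g x) h) with
      ((beta n x (s h) - a n x (s h)) + (a n x (s h) - a n (gmul G g x) h)
       + - (beta n (gmul G g x) h - a n (gmul G g x) h)) by ring.
    eapply Rle_trans; [apply Rabs_triang|]. rewrite Rabs_Ropp.
    apply Rplus_le_compat_r, Rabs_triang.
Qed.

(** Along the orbit of one point [x0], the action on [X] becomes left translation on [G];
    compactness of [X] supplies the uniform tightness that rounding requires. *)
Lemma amenable_at_infinity_cube (G : group) : countable_group G -> amenable_at_infinity G ->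
  exists act : G -> hcube -> hcube,
    is_action G hcube_open act /\ amenable_action G hcube_open act.
Proof.
  intros HG (X & op & Hop & HX & _ & [x0] & act & (_ & Hact & _) & b & Hp & Hc & Hb).
  destruct (coarse_discretization G (fun n x => b n (act x x0)) HG)
    as (E & beta & HE & Hbp & Hbs & Hbf & Hba).
  - intros n x. apply Hp.
  - intros n e He. destruct (compact_tight op (b n) Hop (Hp n) (Hc n) e HX He) as (L & HL & H).
    exists L. split; auto.
  - intros g e He. destruct (Hb g e He) as [N HN]. exists N. intros n Hn x L HL.
    rewrite Hact. now apply HN.
  - exists (cube_act G E HE). split; [apply cube_act_is_action|].
    now apply cube_act_amenable with beta.
Qed.

(** * The Hilbert cube is a compact Hausdorff space *)

Section CubeCompact.

Variables (I : Type) (F : I -> hcube -> Prop).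

Definition in_brick (B : (nat -> R) * (nat -> R)) (z : hcube) : Prop :=
  forall k, fst B k <= proj1_sig z k <= snd B k.

Definition bad (B : (nat -> R) * (nat -> R)) : Prop :=
  ~ exists L : list I, forall z, in_brick B z -> exists i, In i L /\ F i z.

Definition upd (f : nat -> R) (c : nat) (v : R) (k : nat) : R :=
  if Nat.eq_dec k c then v else f k.

Definition left_half (c : nat) (B : (nat -> R) * (nat -> R)) :=
  (fst B, upd (snd B) c ((fst B c + snd B c) / 2)).

Definition right_half (c : nat) (B : (nat -> R) * (nat -> R)) :=
  (upd (fst B) c ((fst B c + snd B c) / 2), snd B).

Definition half (c : nat) (B : (nat -> R) * (nat -> R)) :=
  if dec (bad (left_half c B)) then left_half c B else right_half c B.

(** Finite subcovers of both halves would combine into one of the whole brick. *)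
Lemma half_bad c B : bad B -> bad (half c B).
Proof.
  intros HB. unfold half. destruct (dec_spec (bad (left_half c B))) as [H|H]; trivial.
  intros [L HL]. apply NNPP in H. destruct H as [L' HL'].
  apply HB. exists (L ++ L'). intros z Hz.
  destruct (Rle_dec (proj1_sig z c) ((fst B c + snd B c) / 2)) as [Hc|Hc].
  - destruct (HL' z) as (i & Hi & Fi).
    + intros k. cbn. unfold upd. destruct Nat.eq_dec as [->|]; [split; [apply Hz|lra]|apply Hz].
    + exists i. split; trivial. apply in_app_iff. now right.
  - destruct (HL z) as (i & Hi & Fi).
    + intros k. cbn. unfold upd. destruct Nat.eq_dec as [->|]; [split; [lra|apply Hz]|apply Hz].
    + exists i. split; trivial. apply in_app_iff. now left.
Qed.

Lemma half_nested c B k : fst B k <= snd B k ->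
  fst B k <= fst (half c B) k /\ fst (half c B) k <= snd (half c B) k /\
  snd (half c B) k <= snd B k.
Proof.
  intros H. unfold half. destruct dec; cbn; unfold upd; destruct Nat.eq_dec as [->|]; lra.
Qed.

Lemma half_width c B : snd (half c B) c - fst (half c B) c = (snd B c - fst B c) / 2.
Proof.
  unfold half. destruct dec; cbn; unfold upd; destruct Nat.eq_dec; try easy; lra.
Qed.

(** [fst (Cantor.of_nat n)] takes every value infinitely often. *)
Fixpoint brick (n : nat) : (nat -> R) * (nat -> R) :=
  match n with
  | O => (fun _ => 0, fun _ => 1)
  | S n' => half (fst (Cantor.of_nat n')) (brick n')
  end.

Lemma brick_le n k : fst (brick n) k <= snd (brick n) k.
Proof. induction n as [|n IH]; cbn; [lra|]. now apply half_nested. Qed.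

Lemma brick_nested n n' k : (n <= n')%nat ->
  fst (brick n) k <= fst (brick n') k /\ snd (brick n') k <= snd (brick n) k.
Proof.
  intros H. induction H as [|n' H IH]; [lra|]. cbn.
  pose proof (half_nested (fst (of_nat n')) (brick n') k (brick_le n' k)). lra.
Qed.

Lemma brick_thin k j : exists n, snd (brick n) k - fst (brick n) k <= (1 / 2) ^ j.
Proof.
  induction j as [|j [n IH]].
  - exists O. cbn. lra.
  (* A step no earlier than [n] at which coordinate [k] is bisected. *)
  - set (n' := to_nat (k, n)). exists (S n').
    assert (Hn : (n <= n')%nat) by (unfold n'; pose proof (to_nat_non_decreasing k n); lia).
    pose proof (brick_nested n n' k Hn) as H. cbn [brick].
    replace (fst (of_nat n')) with k by (unfold n'; now rewrite cancel_of_to).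
    rewrite half_width. cbn [pow]. lra.
Qed.

Lemma brick_thin_upto N e : e > 0 -> exists n, forall k, (k < N)%nat ->
  snd (brick n) k - fst (brick n) k < e.
Proof.
  intros He. induction N as [|N [n IH]].
  - exists O. intros; lia.
  - destruct (pow_lt_1_zero (1 / 2) ltac:(rewrite Rabs_pos_eq; lra) e He) as [j Hj].
    specialize (Hj j (Nat.le_refl j)). rewrite Rabs_pos_eq in Hj by (apply pow_le; lra).
    destruct (brick_thin N j) as [n' Hn']. exists (max n n'). intros k Hk.
    destruct (Nat.eq_dec k N) as [->|].
    + pose proof (brick_nested n' (max n n') N ltac:(lia)). lra.
    + pose proof (brick_nested n (max n n') k ltac:(lia)).
      specialize (IH k ltac:(lia)). lra.
Qed.

(** Nested intervals in each coordinate: the supremum of the lower ends lies below every upper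
    end. *)
Lemma brick_limit : exists z : hcube, forall n, in_brick (brick n) z.
Proof.
  assert (H : forall k, exists x, forall n, fst (brick n) k <= x <= snd (brick n) k).
  { intros k.
    assert (Hub : forall n,
      is_upper_bound (fun x => exists m, x = fst (brick m) k) (snd (brick n) k)).
    { intros n x [m ->]. pose proof (brick_nested n (max n m) k ltac:(lia)).
      pose proof (brick_nested m (max n m) k ltac:(lia)).
      pose proof (brick_le (max n m) k). lra. }
    destruct (completeness (fun x => exists m, x = fst (brick m) k)) as [x [H1 H2]].
    - eexists. apply (Hub O).
    - eexists. now exists O.
    - exists x. intros n. split; [apply H1; now exists n|now apply H2]. }
  apply choice in H. destruct H as [x Hx].
  unshelve eexists (exist _ x _).
  - intros k. apply (Hx k O).
  - intros n k. apply Hx.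
Qed.

(** The bad bricks shrink to a point. The member containing it constrains finitely many coordinates,
    hence contains a thin enough brick: a subcover with one element. *)
Lemma cube_finite_subcover : (forall i, hcube_open (F i)) -> (forall z, exists i, F i z) ->
  exists L : list I, forall z, exists i, In i L /\ F i z.
Proof.
  intros Ho Hc. apply NNPP. intros HL.
  assert (Hb : forall n, bad (brick n)).
  { induction n as [|n IH]; cbn; [|now apply half_bad].
    intros [L H]. apply HL. exists L. intros z. apply H.
    intros k. cbn. apply (proj2_sig z). }
  destruct brick_limit as [z Hz]. destruct (Hc z) as [i Fi].
  destruct (Ho i z Fi) as (N & e & He & HN).
  destruct (brick_thin_upto N e He) as [n Hn].
  apply (Hb n). exists (i :: nil). intros y Hy. exists i. split; [now left|].
  apply HN. intros k Hk. specialize (Hn k Hk). specialize (Hy k). specialize (Hz n k).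
  apply Rabs_def1; lra.
Qed.

End CubeCompact.

Lemma cube_compact : Defs.compact hcube_open.
Proof. intros I F. apply cube_finite_subcover. Qed.

Lemma cube_topology : is_topology hcube_open.
Proof.
  split; [|split].
  - intros z _. now apply (nb_all z (fun _ => True)).
  - intros U V HU HV z [Uz Vz]. apply (nb_and z U V); [now apply HU|now apply HV].
  - intros I F HF z [i Fi].
    apply (nb_imp z (F i) (fun y => exists i, F i y)); [now exists i|now apply HF].
Qed.

Lemma positive_open (f : hcube -> R) : (forall z, cont_at f z) -> hcube_open (fun z => 0 < f z).
Proof. intros Hf z Hz. now apply (nb_pos f z). Qed.

Lemma cube_hausdorff : hausdorff hcube_open.
Proof.
  intros x y Hxy.
  assert (Hk : exists k, proj1_sig x k <> proj1_sig y k).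
  { apply not_all_ex_not. intros H. apply Hxy.
    apply eq_sig_hprop; [intros; apply proof_irrelevance|]. now apply functional_extensionality. }
  destruct Hk as [k Hk]. set (a := proj1_sig x k) in *. set (b := proj1_sig y k) in *.
  (* This vanishes where coordinate [k] is midway between [a] and [b]; it is positive at [x] and
     negative at [y]. *)
  pose (s := fun z : hcube => (a - b) * (proj1_sig z k - (a + b) / 2)).
  assert (Hs : forall z, cont_at s z).
  { intros z. apply cont_at_scal, cont_at_minus; [apply cont_at_coord|apply cont_at_const]. }
  exists (fun z => 0 < s z), (fun z => 0 < - s z). split; [|split; [|split; [|split]]].
  - now apply positive_open.
  - apply positive_open. intros z. now apply cont_at_opp.
  - unfold s. fold a.
    replace ((a - b) * (a - (a + b) / 2)) with (Rsqr (a - b) / 2) by (unfold Rsqr; field).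
    assert (0 < Rsqr (a - b)) by (apply Rsqr_pos_lt; lra). lra.
  - unfold s. fold b.
    replace (- ((a - b) * (b - (a + b) / 2))) with (Rsqr (a - b) / 2) by (unfold Rsqr; field).
    assert (0 < Rsqr (a - b)) by (apply Rsqr_pos_lt; lra). lra.
  - intros z. lra.
Qed.

Lemma cube_inhabited : inhabited hcube.
Proof. constructor. exists (fun _ => 0). intros; lra. Qed.

Theorem theorem3p3p6 (G : group) (HG : countable_group G) :
  amenable_at_infinity G <->
  exists act : G -> hcube -> hcube,
    is_action G hcube_open act /\ amenable_action G hcube_open act.
Proof.
  split.
  - now apply amenable_at_infinity_cube.
  - intros [act Hact]. exists hcube, hcube_open.
    split; [apply cube_topology|]. split; [apply cube_compact|].
    split; [apply cube_hausdorff|]. split; [apply cube_inhabited|]. now exists act.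
Qed.
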